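(* Let $V$ be a vertex operator algebra with central charge $c$, let $W$, $M$ be irreducible ordinary $V$-modules, and let $I\in I\binom{M}{W\;M}$. Let $a\in V$, $v\in W$ and $m\ge2$. Then the following identities of formal power series in $q$ (in $\mathbb C[[q]]q^{h_M-c/24}$) hold: $$\mathrm{tr}|_Mo_I(a[-1]v)q^{L(0)-\frac c{24}}=\mathrm{tr}|_Mo(a)o_I(v)q^{L(0)-\frac c{24}}+\sum_{k=1}^\infty\widetilde G_{2k}(q)\,\mathrm{tr}|_Mo_I(a[2k-1]v)q^{L(0)-\frac c{24}},$$ $$\mathrm{tr}|_Mo_I(a[0]v)q^{L(0)-\frac c{24}}=0,$$ $$\mathrm{tr}|_Mo_I(a[-m]v)q^{L(0)-\frac c{24}}+(-1)^m\sum_{k=1}^\infty\binom{2k-1}{m-1}\widetilde G_{2k}(q)\,\mathrm{tr}|_Mo_I(a[2k-m]v)q^{L(0)-\frac c{24}}=0.$$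
   Context: A vertex operator algebra (VOA) is $(V,Y(\cdot,z),\mathbf 1,\omega)$, $V=\bigoplus_{n\ge0}V_n$, $\dim V_n<\infty$, with the usual axioms; $Y(a,z)=\sum a_{(n)}z^{-n-1}$, $Y(\omega,z)=\sum L(n)z^{-n-2}$. An admissible module is a weak module $M=\bigoplus_{n\in\mathbb N}M(n)$ with $a_{(m)}M(n)\subseteq M(\mathrm{wt}\,a-m-1+n)$; it has conformal weight $h_M$ if $L(0)$ is semisimple with $M(n)$ the eigenspace of eigenvalue $h_M+n$, and is ordinary if also all $\dim M(n)<\infty$. $I\binom{M}{W\;M}$ is the space of intertwining operators: linear maps $I(\cdot,w):W\to\mathrm{End}(M)[[w^{\pm1}]]w^{-h_W}$, $I(v,w)=\sum_{n\in\mathbb Z} v_{(n)}w^{-n-1-h_W}$, satisfying truncation, $I(L(-1)v,w)=\frac d{dw}I(v,w)$ and the Jacobi identity. For $v\in W(n)$: $\deg v=n$, $o_I(v)=v_{(\deg v-1)}$; for homogeneous $a\in V$: $o(a)=a_{(\mathrm{wt}\,a-1)}$ on $M$ (both extended linearly; both preserve every $M(n)$). For an operator $A$ preserving each $M(n)$, $\mathrm{tr}|_MA\,q^{L(0)-c/24}:=\sum_{n\ge0}\mathrm{tr}|_{M(n)}A\;q^{n+h_M-c/24}$. For homogeneous $a$ (extended linearly), $Y_W[a,z]=Y_W(a,e^{2\pi iz}-1)e^{2\pi iz\,\mathrm{wt}\,a}=\sum a[n]z^{-n-1}$, i.e. $a[m]=(2\pi i)^{-m-1}\mathrm{Res}_zY_W(a,z)(\ln(1+z))^m(1+z)^{\mathrm{wt}\,a-1}$.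 $\widetilde G_{2k}(q)=2\zeta(2k)+\frac{2(2\pi i)^{2k}}{(2k-1)!}\sum_{n\ge1}\sigma_{2k-1}(n)q^n\in\mathbb C[[q]]$ for $k\ge1$. Binomial coefficients $\binom{2k-1}{m-1}$ with $2k<m$ are zero; all sums are finite since $a[n]v=0$ for $n\gg0$. *)

(* Defs.v *)
From HB Require Import structures.
From mathcomp Require Import all_boot all_order all_algebra.
From mathcomp Require Import complex.
From mathcomp Require Import all_classical all_reals all_analysis.
Import Order.TTheory GRing.Theory Num.Theory.
Import numFieldNormedType.Exports.

Set Implicit Arguments.
Unset Strict Implicit.
Unset Printing Implicit Defensive.

Local Open Scope classical_set_scope.
Local Open Scope ring_scope.

(* Sums [\sum_(i \in A) F i] below are finite-support sums: every one of them
   is used where only finitely many terms are nonzero, by truncation or by the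
   finiteness of homogeneous decompositions. The scalars are the complex
   numbers R[i] over R : realType. *)

Section PowerSeries.
Variable C : fieldType.

Definition binz (m : int) (k : nat) : C :=
  (\prod_(j < k) (m%:~R - j%:R)) / k`!%:R.

(* A power series in one variable is its sequence of coefficients. *)
Definition ps_one : nat -> C := fun n => (n == 0)%N%:R.
Definition ps_mul (f g : nat -> C) : nat -> C :=
  fun n => \sum_(i < n.+1) f i * g (n - i)%N.
Definition ps_exp (f : nat -> C) (k : nat) : nat -> C :=
  iter k (ps_mul f) ps_one.
(* Inverse of a series with constant term 1, by the geometric series
   f^-1 = \sum_k (1 - f)^k; (1 - f)^k only has terms of order >= k. *)
Definition ps_inv (f : nat -> C) : nat -> C :=
  fun n => \sum_(k < n.+1) ps_exp (fun j => ps_one j - f j) k n.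
Definition ps_expz (f : nat -> C) (m : int) : nat -> C :=
  match m with
  | Posz k => ps_exp f k
  | Negz k => ps_exp (ps_inv f) k.+1
  end.

(* ln(1+z) / z *)
Definition ps_ln1z_divz : nat -> C := fun k => (-1) ^+ k / k.+1%:R.
(* (1+z)^r for r an integer *)
Definition ps_1z_expz (r : int) : nat -> C := binz r.

(* (ln(1+z))^m (1+z)^r = z^m \sum_j (ln_coef m r j) z^j *)
Definition ln_coef (m r : int) : nat -> C :=
  ps_mul (ps_expz ps_ln1z_divz m) (ps_1z_expz r).

End PowerSeries.

Section LinearAlgebra.
Variables (C : fieldType) (U : lmodType C).

Definition subspace (S : set U) : Prop :=
  S 0 /\ forall (k : C) (x y : U), S x -> S y -> S (k *: x + y).

Definition is_basis (S : set U) (d : nat) (b : 'I_d -> U) : Prop :=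
  (forall i, S (b i)) /\
  forall x, S x -> exists! k : 'rV[C]_d, x = \sum_i k 0 i *: b i.

Definition finite_dim (S : set U) : Prop :=
  exists (d : nat) (b : 'I_d -> U), is_basis S b.

(* Trace on S of an operator A preserving the finite-dimensional subspace S:
   the trace of the matrix of A in a basis of S (default value 0). *)
Definition is_trace (S : set U) (A : U -> U) (t : C) : Prop :=
  exists (d : nat) (b : 'I_d -> U) (P : 'M[C]_d),
    [/\ is_basis S b,
        forall j, A (b j) = \sum_i P i j *: b i
      & t = \tr P].
Definition trace_on (S : set U) (A : U -> U) : C := xget 0 (is_trace S A).

(* A decomposition of U as a direct sum of subspaces U(n), n : nat, given by
   the projections onto the summands. *)
Record grading := Grading {
  gproj : nat -> {linear U -> U};
  gproj_orth : forall m n x,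
    gproj m (gproj n x) = if m == n then gproj n x else 0;
  gproj_sum : forall x, exists N : nat, x = \sum_(n < N) gproj n x
}.

Definition gcomp (G : grading) (n : nat) : set U := [set x | gproj G n x = x].

(* U(n) = 0 for n < 0 *)
Definition gcompz (G : grading) (n : int) : set U :=
  match n with
  | Posz k => gcomp G k
  | Negz _ => [set 0]
  end.

End LinearAlgebra.

Section Modes.
Variable C : fieldType.

(* [Y a n x] is the mode a_(n) x. *)

Definition mode_linear (U M N : lmodType C) (Y : U -> int -> M -> N) : Prop :=
  forall n : int,
    (forall x : M, linear (fun a : U => Y a n x)) /\
    (forall a : U, linear (Y a n)).

Definition truncated (U M N : lmodType C) (Y : U -> int -> M -> N) : Prop :=
  forall a x, exists n0 : int, forall n : int, n0 <= n -> Y a n x = 0.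

(* The Jacobi identity
     z0^-1 delta((z1-z2)/z0) YM(a,z1) I(v,z2)
       - z0^-1 delta((-z2+z1)/z0) I(v,z2) YM(a,z1)
     = z2^-1 delta((z1-z0)/z2) I(YW(a,z0)v, z2),
   read off coefficientwise at z0^(-l-1) z1^(-m-1) z2^(-n-1) (times z2^(-h_W)
   when I is an intertwining operator). *)
Definition jacobi (V W M : lmodType C) (YW : V -> int -> W -> W)
    (YM : V -> int -> M -> M) (I : W -> int -> M -> M) : Prop :=
  forall (a : V) (v : W) (x : M) (l m n : int),
    \sum_(i \in [set: nat]) binz C m i *: I (YW a (l + i%:Z) v) (m + n - i%:Z) x
    = \sum_(i \in [set: nat]) ((-1) ^+ i * binz C l i) *:
        (YM a (m + l - i%:Z) (I v (n + i%:Z) x)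
         - (-1) ^ l *: I v (n + l - i%:Z) (YM a (m + i%:Z) x)).

Definition vacuum_id (V M : lmodType C) (vac : V) (Y : V -> int -> M -> M) :
    Prop :=
  forall (n : int) (x : M), Y vac n x = if n == -1 then x else 0.

Definition Lmode (V M : lmodType C) (omega : V) (Y : V -> int -> M -> M)
    (n : int) : M -> M := Y omega (n + 1).

End Modes.

Section VOA.
Variable R : realType.
Local Notation C := (R[i]).

Record voa := VOA {
  voa_sort :> lmodType C;
  voa_gr : grading voa_sort;
  voa_Y : voa_sort -> int -> voa_sort -> voa_sort;
  vacuum : voa_sort;
  conformal : voa_sort;
  central_charge : C;
  voa_fin_dim : forall n, finite_dim (gcomp voa_gr n);
  voa_linear : mode_linear voa_Y;
  voa_truncated : truncated voa_Y;
  voa_vacuum : vacuum_id vacuum voa_Y;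
  voa_creation : forall a : voa_sort,
    voa_Y a (-1) vacuum = a /\
    forall n : int, 0 <= n -> voa_Y a n vacuum = 0;
  voa_jacobi : jacobi voa_Y voa_Y voa_Y;
  voa_vacuum_wt : gcomp voa_gr 0 vacuum;
  voa_conformal_wt : gcomp voa_gr 2 conformal;
  voa_virasoro : forall (m n : int) (x : voa_sort),
    let L := Lmode conformal voa_Y in
    L m (L n x) - L n (L m x) =
      (m - n)%:~R *: L (m + n) x
      + (if m + n == 0 then (m ^+ 3 - m)%:~R / 12%:R * central_charge else 0)
          *: x;
  voa_L0 : forall n,
    gcomp voa_gr n = [set x | Lmode conformal voa_Y 0 x = n%:R *: x];
  voa_Lm1 : forall (a : voa_sort) (n : int) (x : voa_sort),
    voa_Y (Lmode conformal voa_Y (-1) a) n x = (- n)%:~R *: voa_Y a (n - 1) x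
}.

Variable V : voa.

Record weak_module := WeakModule {
  wmod_sort :> lmodType C;
  mod_Y : V -> int -> wmod_sort -> wmod_sort;
  mod_linear : mode_linear mod_Y;
  mod_truncated : truncated mod_Y;
  mod_vacuum : vacuum_id (vacuum V) mod_Y;
  mod_jacobi : jacobi (@voa_Y V) mod_Y mod_Y
}.

Definition mod_L (M : weak_module) : int -> M -> M :=
  Lmode (conformal V) (@mod_Y M).

Definition irreducible_module (M : weak_module) : Prop :=
  (exists x : M, x != 0) /\
  forall S : set M, subspace S ->
    (forall (a : V) (n : int) (x : M), S x -> S (mod_Y a n x)) ->
    S = [set 0] \/ S = setT.

Record admissible_module := AdmissibleModule {
  amod_weak :> weak_module;
  mod_gr : grading amod_weak;
  mod_graded : forall (k n : nat) (m : int) (a : V) (x : amod_weak),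
    gcomp (voa_gr V) k a -> gcomp mod_gr n x ->
    gcompz mod_gr (k%:Z - m - 1 + n%:Z) (mod_Y a m x)
}.

(* As M is the direct sum of the M(n), this includes semisimplicity of L(0). *)
Definition has_conformal_weight (M : admissible_module) (h : C) : Prop :=
  forall n, gcomp (mod_gr M) n = [set x : M | mod_L 0 x = (h + n%:R) *: x].

Record ordinary_module := OrdinaryModule {
  omod_adm :> admissible_module;
  conf_weight : C;
  conf_weightP : has_conformal_weight omod_adm conf_weight;
  omod_fin_dim : forall n, finite_dim (gcomp (mod_gr omod_adm) n)
}.

(* An intertwining operator of type (M over W M):
   I(v,w) = \sum_n v_(n) w^(-n-1-h_W), with [io_mode v n] the mode v_(n). *)
Record intertwining_operator (W M : ordinary_module) := IntertwiningOperator {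
  io_mode : W -> int -> M -> M;
  io_linear : mode_linear io_mode;
  io_truncated : truncated io_mode;
  io_Lm1 : forall (v : W) (n : int) (x : M),
    io_mode (mod_L (-1) v) n x =
      (- n%:~R - conf_weight W) *: io_mode v (n - 1) x;
  io_jacobi : jacobi (@mod_Y W) (@mod_Y M) io_mode
}.

(* o(a) and o_I(v), extended linearly from homogeneous elements *)
Definition zero_mode (M : ordinary_module) (a : V) (x : M) : M :=
  \sum_(k \in [set: nat]) mod_Y (gproj (voa_gr V) k a) (k%:Z - 1) x.

Definition io_zero_mode (W M : ordinary_module) (I : intertwining_operator W M)
    (v : W) (x : M) : M :=
  \sum_(n \in [set: nat]) io_mode I (gproj (mod_gr W) n v) (n%:Z - 1) x.

Definition two_pi_i : C := (0 +i* (2 * pi))%C.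

(* a[m] v = (2 pi i)^(-m-1) Res_z Y(a,z) (ln(1+z))^m (1+z)^(wt a - 1) v for a
   homogeneous, extended linearly in a *)
Definition sq_mode (W : ordinary_module) (a : V) (m : int) (v : W) : W :=
  \sum_(k \in [set: nat])
    two_pi_i ^ (- m - 1) *:
      \sum_(j \in [set: nat])
        ln_coef C m (k%:Z - 1) j *:
          mod_Y (gproj (voa_gr V) k a) (m + j%:Z) v.

(* Formal series \sum_e (S e) q^e with complex exponents e. *)
Definition qseries := C -> C.

(* tr|_M A q^(L(0)-c/24) = \sum_n tr|_M(n) A q^(n+h_M-c/24) *)
Definition qtrace (M : ordinary_module) (A : M -> M) : qseries :=
  fun e =>
    \sum_(n \in [set n : nat |
                   n%:R + conf_weight M - central_charge V / 24%:R = e])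
      trace_on (gcomp (mod_gr M) n) A.

(* Product of a power series in C[[q]] with a series supported on s + nat. *)
Definition qmul (f : nat -> C) (S : qseries) : qseries :=
  fun e => \sum_(i \in [set: nat]) f i * S (e - i%:R).

End VOA.

Section Eisenstein.
Variable R : realType.

Definition zeta (s : nat) : R :=
  limn (series (fun n : nat => (n.+1%:R : R) ^- s)).

Definition sigma (s n : nat) : nat := (\sum_(d <- divisors n) d ^ s)%N.

(* [Gtilde k] is the q-expansion of the Eisenstein series of weight 2k, k > 0 *)
Definition Gtilde (k : nat) : nat -> R[i] := fun n =>
  if n == 0%N then 2%:R * ((zeta (2 * k))%:C)%C
  else 2%:R * two_pi_i R ^+ (2 * k) / ((2 * k - 1)`!)%:R
         * (sigma (2 * k - 1) n)%:R.

End Eisenstein.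

(* Main.v *)
(* For homogeneous a and v put A_s = a_(wt a - 1 + s) and
   B_s = v_(deg v - 1 - s), so that A_s lowers degrees by s and B_s raises them
   by s. Cyclicity of the trace gives tr B_s A_s = q^s tr A_s B_s, while the
   Jacobi identity gives
     [A_s, B_s] = \sum_n (2 pi i)^(n+1) s^n / n! o_I(a[n]v).
   For s = 0 this is the second identity; for s <> 0 it determines both traces,
   with denominator 1 - q^s. The Jacobi identity also writes
   o_I(Res_z z^-1 (1+z)^(wt a - 1) Y(a,z)v) as the sum of the A_s B_s for s < 0
   and of the B_s A_s for s >= 0; the trace of the terms with s <> 0 is a
   combination of Lambert series, the nonconstant parts of the Eisenstein
   series. The constant terms 2 zeta(2k) arise on passing from 1/z to
   1/ln(1+z), whose difference is expanded in powers of ln(1+z). The values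
   zeta(2k) are characterized by Newton's identities for
   sin(pi sqrt X)/(pi sqrt X), as limits of power sums of the numbers
   (pi/(2n+1) cot(k pi/(2n+1)))^2, the inverses of the roots of an explicit
   polynomial. The third identity follows from the first by induction on m,
   replacing a by L[-1]a: (L[-1]a)[n] = - n a[n-1] and o(L[-1]a) = 0. *)

Require Import Defs.
From HB Require Import structures.
From mathcomp Require Import all_boot all_order all_algebra.
From mathcomp Require Import complex.
From mathcomp Require Import all_classical all_reals all_analysis.
From mathcomp Require Import ring zify.
Import Order.TTheory GRing.Theory Num.Theory.
Import numFieldNormedType.Exports.

Set Implicit Arguments.
Unset Strict Implicit.
Unset Printing Implicit Defensive.

Local Open Scope classical_set_scope.
Local Open Scope ring_scope.

(** * Formal power series *)

(** Traces are handled as coefficient sequences: the common exponent [h_M - c/24] is dropped and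
    restored only at the end. All divisions are formal. Division by [1 - q^t] is a recursion in the
    degree whose solution sums over the multiples of [t]; exchanging this with the sum over [t]
    yields divisor sums. The contributions of [s] and [-s] occur with opposite signs, so only odd
    powers of [s] survive, and with them only the modes [a[2k-1]] and even weights. For the constant
    terms the bridge is [Z(u) = 1 - (u/2) coth(u/2)], whose coefficients are
    [2 zeta(2k) / (2 pi i)^(2k)], with [1/u = 1/z + 1/2 + Z(u)/u] for [u = ln(1+z)]. The term [1/2]
    contributes half of the trace of a commutator at [s = 0], so the first identity rests on the
    second. That [Z] involves zeta comes from reading it as a logarithmic derivative: Newton's
    identities compute power sums from coefficients alone, hence survive a limit in which the number
    of roots grows. *)

Definition fps (C : Type) := nat -> C.

Section PowerSeriesRing.
Variable C : fieldType.
Implicit Types f g h : fps C.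

HB.instance Definition _ := GRing.Zmodule.copy (fps C) (nat -> C).

(** Coefficients up to [n] of a Cauchy product only see coefficients up to [n] of the factors;
    associativity and commutativity are thereby borrowed from [{poly C}] by truncation. *)
Lemma coefM_ps (p q : {poly C}) (f g : nat -> C) n :
  (forall i, (i <= n)%N -> p`_i = f i) -> (forall i, (i <= n)%N -> q`_i = g i) ->
  (p * q)`_n = ps_mul f g n.
Proof.
move=> pf qg; rewrite coefM; apply: eq_bigr => i _.
by rewrite pf ?qg ?leq_subr // -ltnS.
Qed.

Definition fps_trunc n f : {poly C} := \poly_(i < n.+1) f i.

Lemma fps_truncE n f i : (i <= n)%N -> (fps_trunc n f)`_i = f i.
Proof. by move=> le_in; rewrite coef_poly ltnS le_in. Qed.

Lemma fps_mulA : associative (@ps_mul C).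
Proof.
move=> f g h; apply/funext => n.
have H f1 f2 i : (i <= n)%N ->
    (fps_trunc n f1 * fps_trunc n f2)`_i = ps_mul f1 f2 i.
  by move=> le_in; apply: coefM_ps => j le_ji; rewrite fps_truncE ?(leq_trans le_ji).
have T f1 i : (i <= n)%N -> (fps_trunc n f1)`_i = f1 i by exact: fps_truncE.
rewrite -(coefM_ps (T f) (H g h)) mulrA; exact: coefM_ps (H f g) (T h).
Qed.

Lemma fps_mulC : commutative (@ps_mul C).
Proof.
move=> f g; apply/funext => n.
have T f1 i : (i <= n)%N -> (fps_trunc n f1)`_i = f1 i by exact: fps_truncE.
by rewrite -(coefM_ps (T f) (T g)) mulrC; exact: (coefM_ps (T g) (T f)).
Qed.

Lemma fps_mul1 : left_id (ps_one C) (@ps_mul C).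
Proof.
move=> f; apply/funext => n; rewrite /ps_mul big_ord_recl /ps_one /= mul1r subn0.
by rewrite big1 ?addr0 // => i _; rewrite /= mul0r.
Qed.

Lemma fps_mulDl : left_distributive (@ps_mul C) (+%R : fps C -> fps C -> fps C).
Proof.
move=> f g h; apply/funext => n.
suff: ps_mul (f + g : fps C) h n = ps_mul f h n + ps_mul g h n by [].
rewrite /ps_mul -big_split /=.
by apply: eq_bigr => i _; rewrite mulrDl.
Qed.

Lemma fps_one_neq0 : (ps_one C : fps C) != 0.
Proof.
by apply/eqP => /(congr1 (fun f : nat -> C => f 0%N)) /eqP; rewrite oner_eq0.
Qed.

HB.instance Definition _ := GRing.Zmodule_isComNzRing.Build (fps C)
  fps_mulA fps_mulC fps_mul1 fps_mulDl fps_one_neq0.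

Lemma fpsM f g n : (f * g) n = \sum_(i < n.+1) f i * g (n - i)%N.
Proof. by []. Qed.

Lemma fpsD f g n : (f + g) n = f n + g n. Proof. by []. Qed.

Lemma fpsN f n : (- f) n = - f n. Proof. by []. Qed.

Lemma fps1 n : (1 : fps C) n = (n == 0)%N%:R. Proof. by []. Qed.

Lemma fps_sum (J : Type) (r : seq J) (P : pred J) (F : J -> fps C) n :
  (\sum_(j <- r | P j) F j) n = \sum_(j <- r | P j) F j n.
Proof. exact: (big_morph (fun f : fps C => f n)). Qed.

Lemma fpsMn f k n : (f *+ k) n = f n *+ k.
Proof. by elim: k => [//|k IHk]; rewrite !mulrS fpsD IHk. Qed.

Lemma ps_expE f k : ps_exp f k = f ^+ k.
Proof. by elim: k => [//|k IHk]; rewrite exprS -IHk. Qed.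

Definition fpsC (c : C) : fps C := fun n => if n == 0%N then c else 0.
Definition fpsX : fps C := fun n => (n == 1)%N%:R.

Lemma fpsCM c f n : (fpsC c * f) n = c * f n.
Proof.
rewrite fpsM big_ord_recl /= subn0 /fpsC /=.
by rewrite big1 ?addr0 // => i _; rewrite /= mul0r.
Qed.

Lemma fpsXM0 f : (fpsX * f) 0%N = 0.
Proof. by rewrite fpsM big_ord1 /fpsX mul0r. Qed.

Lemma fpsXMS f n : (fpsX * f) n.+1 = f n.
Proof.
rewrite fpsM 2!big_ord_recl /fpsX /= mul0r add0r mul1r subSS subn0.
by rewrite big1 ?addr0 // => i _; rewrite /= mul0r.
Qed.

Lemma fpsXnM f k n : (fpsX ^+ k * f) n = if (k <= n)%N then f (n - k)%N else 0.
Proof.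
elim: k n => [|k IHk] n; first by rewrite mul1r subn0.
rewrite exprS -mulrA; case: n => [|n]; first by rewrite fpsXM0.
by rewrite fpsXMS IHk ltnS subSS.
Qed.

Lemma fpsX_inj f g : fpsX * f = fpsX * g -> f = g.
Proof.
by move=> e; apply/funext => n; rewrite -(fpsXMS f) e fpsXMS.
Qed.

Lemma fpsC_nat k : fpsC k%:R = k%:R.
Proof.
by apply/funext => n; rewrite -(mulr1 (fpsC _)) fpsCM fpsMn mulr_natl fps1.
Qed.

Lemma fpsC0 : fpsC 0 = 0. Proof. exact: (fpsC_nat 0). Qed.

Lemma fpsCD : {morph fpsC : c d / c + d}.
Proof.
by move=> c d; apply/funext => -[|n]; rewrite fpsD /fpsC //= addr0.
Qed.

Lemma fpsCN : {morph fpsC : c / - c}.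
Proof. by move=> c; apply/funext => -[|n]; rewrite fpsN /fpsC //= oppr0. Qed.

Lemma fpsC_M : {morph fpsC : c d / c * d}.
Proof.
by move=> c d; apply/funext => -[|n]; rewrite fpsCM /fpsC //= mulr0.
Qed.

Lemma fpsC_int (m : int) : fpsC m%:~R = m%:~R.
Proof. by case: m => n; rewrite ?NegzE ?mulrNz ?fpsCN -?pmulrn fpsC_nat. Qed.

Lemma fpsM_order f g k l n : (forall i, (i < k)%N -> f i = 0) ->
  (forall i, (i < l)%N -> g i = 0) -> (n < k + l)%N -> (f * g) n = 0.
Proof.
move=> f0 g0 lt_n; rewrite fpsM big1 // => i _.
case: (ltnP i k) => [/f0 ->|le_ki]; first by rewrite mul0r.
by rewrite [g _]g0 ?mulr0 //; have := ltn_ord i; lia.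
Qed.

Lemma fpsX_order f k n : f 0%N = 0 -> (n < k)%N -> (f ^+ k) n = 0.
Proof.
move=> f0; elim: k n => // k IHk n lt_nk; rewrite exprS.
by apply: (@fpsM_order _ _ 1 k) => // -[].
Qed.

(** Up to degree [n] the inverse is the finite geometric sum of [g = 1 - f], whose product with
    [1 - g] is [1 - g ^+ n.+1]; the last power starts in degree [n.+1]. *)
Lemma ps_invE f : f 0%N = 1 -> f * ps_inv f = 1.
Proof.
move=> f0; apply/funext => n.
pose g : fps C := 1 - f.
have g0 : g 0%N = 0 by rewrite /g fpsD fpsN f0 fps1 subrr.
have invE i : (i <= n)%N -> ps_inv f i = (\sum_(k < n.+1) g ^+ k) i.
  move=> le_in; rewrite fps_sum /ps_inv (big_ord_widen n.+1
    (fun k => ps_exp (fun j => ps_one C j - f j) k i)) // big_mkcond /=.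
  apply: eq_bigr => k _; rewrite ps_expE.
  by case: ifPn => // lt_ik; rewrite fpsX_order // ltnNge.
have -> : (f * ps_inv f) n = (f * \sum_(k < n.+1) g ^+ k) n.
  by rewrite !fpsM; apply: eq_bigr => i _; rewrite invE ?leq_subr.
have -> : f = - (g - 1) by rewrite /g; ring.
by rewrite mulNr -subrX1 fpsN fpsD fpsN fpsX_order // sub0r opprK.
Qed.

(** The Euler operator [z d/dz]: a derivation like [d/dz], but without a shift of indices. *)
Definition fps_theta f : fps C := fun n => n%:R * f n.

Lemma thetaD f g : fps_theta (f + g) = fps_theta f + fps_theta g.
Proof. by apply/funext => n; rewrite /fps_theta !fpsD mulrDr. Qed.

Lemma thetaM f g : fps_theta (f * g) = fps_theta f * g + f * fps_theta g.
Proof.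
apply/funext => n; rewrite fpsD /fps_theta !fpsM mulr_sumr -big_split /=.
apply: eq_bigr => i _; have le_in : (i <= n)%N by rewrite -ltnS.
by rewrite -{1}(subnKC le_in) natrD; ring.
Qed.

Lemma theta1 : fps_theta 1 = 0.
Proof. by apply/funext => -[|n]; rewrite /fps_theta ?mul0r // fps1 mulr0. Qed.

Lemma thetaX : fps_theta fpsX = fpsX.
Proof.
apply/funext => -[|[|n]]; rewrite /fps_theta /fpsX /= ?mul0r ?mulr0 //.
by rewrite mul1r.
Qed.

Lemma thetaXn f n : fps_theta (f ^+ n.+1) = n.+1%:R * f ^+ n * fps_theta f.
Proof.
elim: n => [|n IHn]; first by rewrite expr1 expr0 !mul1r.
by rewrite exprS thetaM IHn [in LHS]exprS [in RHS]exprS [n.+2%:R]mulrS; ring.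
Qed.

(** * Substitution of a series without constant term *)

Section Composition.
Variable u : fps C.
Hypothesis u0 : u 0%N = 0.

Definition fps_comp f : fps C := fun n => \sum_(j < n.+1) f j * (u ^+ j) n.

(** Any cutoff [N >= n] gives the same coefficient, because [u ^+ j] starts in degree [j].
    Composition thus becomes a finite sum in the ring of series. *)
Lemma fps_compE N f n : (n <= N)%N ->
  fps_comp f n = (\sum_(j < N.+1) fpsC (f j) * u ^+ j) n.
Proof.
move=> le_nN; rewrite fps_sum /fps_comp
  (big_ord_widen N.+1 (fun j => f j * (u ^+ j) n)) // big_mkcond /=.
apply: eq_bigr => j _; rewrite fpsCM.
by case: ifPn => // lt_nj; rewrite fpsX_order ?mulr0 // ltnNge.
Qed.

Lemma fps_compD f g : fps_comp (f + g) = fps_comp f + fps_comp g.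
Proof.
apply/funext => n; rewrite fpsD /fps_comp -big_split /=.
by apply: eq_bigr => j _; rewrite mulrDl.
Qed.

(** In degree [n] both sides are the double sum of [f i * g j * u ^+ (i + j)] over [i, j <= n],
    regrouped by [k = i + j]; pairs with [i + j > n] drop out by order. *)
Lemma fps_compM f g : fps_comp (f * g) = fps_comp f * fps_comp g.
Proof.
apply/funext => n.
have -> : (fps_comp f * fps_comp g) n =
    (\sum_(i < n.+1) \sum_(j < n.+1) fpsC (f i * g j) * u ^+ (i + j)) n.
  rewrite fpsM (eq_bigr (fun i : 'I_n.+1 =>
      (\sum_(j < n.+1) fpsC (f j) * u ^+ j) i *
      (\sum_(j < n.+1) fpsC (g j) * u ^+ j) (n - i)%N)); last first.
    by move=> i _; rewrite -!fps_compE ?leq_subr // -ltnS.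
  rewrite -fpsM mulr_suml; congr (_ n); apply: eq_bigr => i _.
  by rewrite mulr_sumr; apply: eq_bigr => j _; rewrite fpsC_M exprD mulrACA.
have H (i : 'I_n.+1) :
    (\sum_(j < n.+1) fpsC (f i * g j) * u ^+ (i + j)) n =
    \sum_(k < n.+1 | (i <= k)%N) f i * g (k - i)%N * (u ^+ k) n.
  rewrite fps_sum; pose F j := f i * g j * (u ^+ (i + j)) n.
  rewrite (eq_bigr (fun j : 'I_n.+1 => F j)); last by move=> j _; rewrite fpsCM.
  rewrite -(big_mkord xpredT F) -(big_mkord (fun k => (i <= k)%N)
    (fun k => f i * g (k - i)%N * (u ^+ k) n)).
  have le_i : (i <= n)%N by rewrite -ltnS.
  rewrite (@big_cat_nat _ _ _ (n.+1 - i)%N) ?leq_subr //= [X in _ + X]big_nat_cond.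
  rewrite [X in _ + X]big1 ?addr0; last first.
    by move=> j /andP[/andP[lt_j _] _]; rewrite /F fpsX_order ?mulr0 //; lia.
  rewrite [RHS](@big_cat_nat _ _ _ i) ?(leqW le_i) //= [X in _ = X + _]big_nat_cond.
  rewrite [X in _ = X + _]big1 ?add0r; last by move=> j; lia.
  transitivity (\sum_(0 + i <= k < n.+1 | (i <= k)%N)
      f i * g (k - i)%N * (u ^+ k) n) => //.
  rewrite big_addn; apply: eq_big => j; first by rewrite leq_addl.
  by rewrite /F addnK addnC.
rewrite fps_sum (eq_bigr _ (fun i _ => H i)).
rewrite (exchange_big_dep xpredT) //= /fps_comp; apply: eq_bigr => k _.
rewrite fpsM mulr_suml (big_ord_widen_cond n.+1 xpredT
  (fun i => f i * g (k - i)%N * (u ^+ k) n)) //.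
Qed.

Lemma fps_comp1 : fps_comp 1 = 1.
Proof.
apply/funext => n; rewrite (@fps_compE n) // big_ord_recl expr0 mulr1.
by rewrite big1 ?addr0 ?fpsC_nat // => i _; rewrite fps1 fpsC_nat mul0r.
Qed.

Lemma fps_compX : fps_comp fpsX = u.
Proof.
apply/funext => n; rewrite (@fps_compE n.+1) // 2!big_ord_recl expr1.
rewrite /= {1 2}/fpsX /= !fpsC_nat mul0r add0r mul1r.
by rewrite big1 ?addr0 // => i _; rewrite mul0r.
Qed.

Lemma fps_compC c : fps_comp (fpsC c) = fpsC c.
Proof.
apply/funext => n; rewrite (@fps_compE n) // big_ord_recl expr0 mulr1.
by rewrite big1 ?addr0 // => i _; rewrite [X in fpsC X]/(0) fpsC0 mul0r.
Qed.

Lemma fps_compN f : fps_comp (- f) = - fps_comp f.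
Proof.
apply/funext => n; rewrite fpsN /fps_comp -sumrN.
by apply: eq_bigr => j _; rewrite fpsN mulNr.
Qed.

Definition fps_deriv f : fps C := fun n => n.+1%:R * f n.+1.

(** The chain rule; it reduces to the power rule [thetaXn] for each [u ^+ j.+1]. *)
Lemma theta_comp f : fps_theta (fps_comp f) = fps_comp (fps_deriv f) * fps_theta u.
Proof.
apply/funext => -[|m].
  by rewrite /fps_theta mul0r fpsM big_ord1 subnn mul0r mulr0.
transitivity ((\sum_(j < m.+1) fpsC (fps_deriv f j) * u ^+ j * fps_theta u) m.+1).
  rewrite {1}/fps_theta (@fps_compE m.+1) // !fps_sum mulr_sumr big_ord_recl.
  rewrite expr0 mulr1 {1}/fpsC /= mulr0 add0r; apply: eq_bigr => j _.
  rewrite /fps_deriv /bump /= add1n -mulrA !fpsCM.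
  transitivity (f j.+1 * fps_theta (u ^+ j.+1) m.+1).
    by rewrite /fps_theta mulrCA.
  by rewrite thetaXn -fpsC_nat -mulrA fpsCM mulrCA mulrA.
rewrite -mulr_suml !fpsM [LHS]big_ord_recr [RHS]big_ord_recr /= subnn.
have -> : fps_theta u 0%N = 0 by rewrite /fps_theta mul0r.
rewrite !mulr0 !addr0; apply: eq_bigr => i _.
by rewrite -fps_compE // -ltnS.
Qed.

End Composition.
End PowerSeriesRing.

(** * The series of [(1+z)^x], of the exponential and of [ln(1+z)] *)

Section BinomialSeries.
Variable C : numFieldType.
Implicit Types (f g : fps C) (x y r s : C).

(** The binomial series of [(1+z)^x] for a scalar exponent; [binz] is its restriction to
    integers. *)
Definition gbin x : fps C := fun k => (\prod_(j < k) (x - j%:R)) / k`!%:R.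

Definition fexp r : fps C := fun n => r ^+ n / n`!%:R.

Let lam : fps C := ps_ln1z_divz C.

Lemma natrS_neq0 n : n.+1%:R != 0 :> C. Proof. by rewrite pnatr_eq0. Qed.

Lemma factr_neq0 n : n`!%:R != 0 :> C.
Proof. by rewrite pnatr_eq0 -lt0n fact_gt0. Qed.

Lemma gbin0 x : gbin x 0 = 1. Proof. by rewrite /gbin big_ord0 divr1. Qed.

Lemma gbinS x n : n.+1%:R * gbin x n.+1 = (x - n%:R) * gbin x n.
Proof.
rewrite /gbin big_ord_recr factS natrM /=.
by field; rewrite addrC natr1 natrS_neq0 factr_neq0.
Qed.

Lemma fexp0 r : fexp r 0 = 1. Proof. by rewrite /fexp expr0 divr1. Qed.

Lemma theta_gbin x : (1 + fpsX C) * fps_theta (gbin x) = fpsC x * (fpsX C * gbin x).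
Proof.
apply/funext => -[|n]; rewrite mulrDl mul1r fpsD fpsCM.
  by rewrite !fpsXM0 addr0 mulr0 /fps_theta mul0r.
by rewrite !fpsXMS /fps_theta gbinS -mulrDl subrK.
Qed.

(* The differential equation (1 + z) f' = x f characterizes (1 + z)^x. *)
Lemma gbin_uniq x f : f 0%N = 1 ->
  (1 + fpsX C) * fps_theta f = fpsC x * (fpsX C * f) -> f = gbin x.
Proof.
move=> f0 ef; apply/funext; elim=> [|n IHn]; first by rewrite f0 gbin0.
have /= := congr1 (fun g : fps C => g n.+1) ef.
rewrite mulrDl mul1r fpsD fpsCM !fpsXMS /fps_theta => e.
apply: (mulfI (natrS_neq0 n)); rewrite gbinS -IHn mulrBl -e.
by rewrite addrK.
Qed.

Lemma fexp_uniq r f : f 0%N = 1 ->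
  fps_theta f = fpsC r * (fpsX C * f) -> f = fexp r.
Proof.
move=> f0 ef; apply/funext; elim=> [|n IHn]; first by rewrite f0 fexp0.
have /= := congr1 (fun g : fps C => g n.+1) ef.
rewrite fpsCM !fpsXMS /fps_theta IHn => e.
apply: (mulfI (natrS_neq0 n)); rewrite e /fexp factS natrM exprS.
by field; rewrite addrC natr1 natrS_neq0 factr_neq0.
Qed.

Lemma theta_fexp r : fps_theta (fexp r) = fpsC r * (fpsX C * fexp r).
Proof.
apply/funext => -[|n]; rewrite /fps_theta fpsCM ?fpsXM0 ?mulr0 ?mul0r //.
rewrite fpsXMS /fexp factS natrM exprS.
by field; rewrite addrC natr1 natrS_neq0 factr_neq0.
Qed.

Lemma fpsM_const f g : (f * g) 0%N = f 0%N * g 0%N.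
Proof. by rewrite fpsM big_ord1. Qed.

Lemma fexpD r s : fexp (r + s) = fexp r * fexp s.
Proof.
apply/esym/fexp_uniq; first by rewrite fpsM_const !fexp0 mulr1.
by rewrite thetaM !theta_fexp fpsCD; ring.
Qed.

Lemma gbinD x y : gbin (x + y) = gbin x * gbin y.
Proof.
apply/esym/gbin_uniq; first by rewrite fpsM_const !gbin0 mulr1.
rewrite thetaM mulrDr [_ * (gbin x * _)]mulrCA mulrA !theta_gbin fpsCD; ring.
Qed.

Lemma gbin_0 : gbin 0 = 1.
Proof. by apply/esym/gbin_uniq => //; rewrite theta1 fpsC0 mulr0 mul0r. Qed.

Lemma gbin_1 : gbin 1 = 1 + fpsX C.
Proof.
apply/esym/gbin_uniq; first by rewrite fpsD fps1 /fpsX addr0.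
by rewrite thetaD theta1 thetaX (fpsC_nat _ 1) add0r mul1r mulrC.
Qed.

Lemma theta_gbinP x : fps_theta (gbin x) = fpsC x * (fpsX C * gbin (x - 1)).
Proof.
have inv1 : gbin (-1) * (1 + fpsX C) = 1.
  by rewrite -gbin_1 -gbinD addNr gbin_0.
rewrite -[LHS]mul1r -inv1 -mulrA theta_gbin gbinD; ring.
Qed.

(** [lam + fps_theta lam] is the derivative of [z lam = ln(1+z)], namely the geometric series of
    [1/(1+z)]. *)
Lemma theta_lam : (1 + fpsX C) * (lam + fps_theta lam) = 1.
Proof.
have e n : (lam + fps_theta lam) n = (-1) ^+ n.
  rewrite fpsD /fps_theta /lam /ps_ln1z_divz.
  by field; rewrite addrC natr1 natrS_neq0.
apply/funext => -[|n]; rewrite mulrDl mul1r fpsD.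
  by rewrite fpsXM0 addr0 e.
by rewrite fpsXMS !e exprS mulN1r addNr.
Qed.

Lemma lam0 : lam 0%N = 1. Proof. by rewrite /lam /ps_ln1z_divz expr0 divr1. Qed.

Definition fps_lnz (m : int) : fps C := ps_expz lam m.

Lemma lnzS m : fps_lnz (m + 1) = lam * fps_lnz m.
Proof.
case: m => [n|n].
  by rewrite -PoszD addn1 /fps_lnz /ps_expz !ps_expE exprS.
have -> : (Negz n + 1 = - n%:Z)%R by rewrite NegzE -addn1 PoszD opprD subrK.
pose mu : fps C := ps_inv lam.
have lamK : lam * mu = 1 by rewrite ps_invE ?lam0.
case: n => [|n].
  transitivity (lam * mu ^+ 1); first by rewrite expr1 lamK.
  by rewrite -ps_expE.
rewrite -NegzE; transitivity (lam * mu ^+ n.+2); last by rewrite -ps_expE.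
by rewrite exprS mulrA lamK mul1r -ps_expE.
Qed.

(** The power rule for exponents of either sign. Multiplied by [lam], it has the same exponent on
    both sides, and the induction can run upwards and downwards. *)
Lemma theta_lnz m :
  fps_theta (fps_lnz m) = m%:~R * fps_lnz (m - 1) * fps_theta lam.
Proof.
pose mu : fps C := ps_inv lam.
have lamK f : mu * (lam * f) = f.
  by rewrite mulrA [mu * _]mulrC ps_invE ?lam0 // mul1r.
suff H : lam * fps_theta (fps_lnz m) = m%:~R * fps_lnz m * fps_theta lam.
  have E : fps_lnz m = lam * fps_lnz (m - 1) by rewrite -lnzS subrK.
  by rewrite -[LHS]lamK H E -[RHS]lamK; ring.
elim/int_ind: m => [|n IHn|n IHn]; first by rewrite theta1 mulr0 !mul0r.
  by rewrite -addn1 PoszD lnzS thetaM mulrDr mulrA [lam * _ * _]mulrAC IHn intrD; ring.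
have e : - n%:Z = - n.+1%:Z + 1 by rewrite -addn1 PoszD opprD subrK.
move: IHn; rewrite e lnzS intrD; set Q := fps_lnz _; rewrite thetaM => IHn.
apply: (can_inj lamK).
transitivity (lam * (fps_theta lam * Q + lam * fps_theta Q) - lam * fps_theta lam * Q).
  by ring.
by rewrite IHn; ring.
Qed.

Lemma binzE (m : int) : binz C m = gbin m%:~R. Proof. by []. Qed.

Lemma ln_coefE (m r : int) : ln_coef C m r = fps_lnz m * gbin r%:~R.
Proof. by []. Qed.

(* the derivative of [(ln(1+z))^n (1+z)^r] *)
Lemma ln_coef_rec (n r : int) (j : nat) :
  (n + j%:Z)%:~R * ln_coef C n r j =
  n%:~R * ln_coef C (n - 1) (r - 1) j +
  r%:~R * (if j is i.+1 then ln_coef C n (r - 1) i else 0).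
Proof.
(* [ln_coef] omits the factor [z^n], which turns the Euler operator into [fps_theta + n]. The two
   terms on the right differentiate the power of the logarithm and the power of [1+z]. *)
have H : fps_theta (ln_coef C n r) + fpsC n%:~R * ln_coef C n r =
    fpsC n%:~R * ln_coef C (n - 1) (r - 1) +
    fpsC r%:~R * (fpsX C * ln_coef C n (r - 1)).
  rewrite !ln_coefE thetaM theta_lnz theta_gbinP !fpsC_int intrB.
  have -> : gbin r%:~R = (1 + fpsX C) * gbin (r%:~R - 1).
    by rewrite -gbin_1 -gbinD addrC subrK.
  have E : fps_lnz n = lam * fps_lnz (n - 1) by rewrite -lnzS subrK.
  rewrite [1%:~R]/(1) E; set Q := fps_lnz (n - 1).
  set B := gbin _.
  transitivity (n%:~R * Q * B * ((1 + fpsX C) * (lam + fps_theta lam)) +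
    r%:~R * (fpsX C * (lam * Q * B))); first by ring.
  by rewrite theta_lam; ring.
have := congr1 (fun f : fps C => f j) H.
rewrite !fpsD !fpsCM /fps_theta -mulrDl addrC intrD => ->.
by case: j => [|j]; rewrite ?fpsXM0 ?fpsXMS.
Qed.

Definition fps_ln : fps C := fpsX C * lam.

Lemma ln_const0 : fps_ln 0%N = 0. Proof. exact: fpsXM0. Qed.

(** The composite [exp(r ln(1+z))] satisfies the differential equation that characterizes
    [(1+z)^r]. *)
Lemma fexp_ln r : fps_comp fps_ln (fexp r) = gbin r.
Proof.
apply: gbin_uniq.
  by rewrite /fps_comp big_ord1 fexp0 expr0 mulr1.
rewrite theta_comp; last exact: ln_const0.
have -> : fps_deriv (fexp r) = fpsC r * fexp r.
  apply/funext => n; rewrite fpsCM /fps_deriv /fexp factS natrM exprS.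
  by field; rewrite addrC natr1 natrS_neq0 factr_neq0.
rewrite fps_compM ?fps_compC; try exact: ln_const0.
rewrite /fps_ln thetaM thetaX -[X in X * lam + _]mulr1.
set E := fps_comp _ _.
transitivity (fpsC r * (fpsX C * ((1 + fpsX C) * (lam + fps_theta lam)) * E)).
  by ring.
by rewrite theta_lam mulr1.
Qed.

Lemma fps_lnzX n : fps_lnz n%:Z = lam ^+ n.
Proof. exact: ps_expE. Qed.

(** Expansion of [(1+z)^s = exp(s ln(1+z))] in powers of [ln(1+z)]: it turns the binomial sums of
    the commutator formula into the modes [a[n]]. *)
Lemma binz_ln_coef (r s : int) i :
  binz C (r + s) i = \sum_(n < i.+1) s%:~R ^+ n / n`!%:R * ln_coef C n%:Z r (i - n)%N.
Proof.
rewrite binzE intrD gbinD -(fexp_ln s%:~R) mulrC.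
rewrite fpsM (eq_bigr (fun k : 'I_i.+1 => 
   (\sum_(j < i.+1) fpsC (fexp s%:~R j) * fps_ln ^+ j) k * gbin r%:~R (i - k)%N)).
  rewrite -fpsM mulr_suml fps_sum; apply: eq_bigr => n _.
  rewrite -mulrA fpsCM /fps_ln exprMn -[_ * _ * gbin _]mulrA fpsXnM -ltnS ltn_ord.
  by rewrite ln_coefE fps_lnzX.
by move=> k _; rewrite -fps_compE // ?ln_const0 // -ltnS.
Qed.

(* The hypotheses say that [S = 2 sinh(u/2) / u] and [u S' = - Z S], that is
   [Z = 1 - (u/2) coth(u/2)]; the substitution [u = ln(1+z)] then gives
   [z / u = 1 + z/2 + (z / u) Z]. *)
Lemma ln_coefN1 (Z S : fps C) (r : int) j :
  (forall n, S n = ((1 / 2) ^+ n.+1 - (- (1 / 2)) ^+ n.+1) / n.+1`!%:R) ->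
  Z * S = - fps_theta S ->
  ln_coef C (-1) r j = binz C r j + 1 / 2 * (if j is i.+1 then binz C r i else 0)
    + \sum_(n < j.+1) Z n * ln_coef C (n%:Z - 1) r (j - n)%N.
Proof.
move=> SE ZS.
have XS : fpsX C * S = fexp (1 / 2) - fexp (- (1 / 2)).
  apply/funext => -[|n]; first by rewrite fpsXM0 fpsD fpsN !fexp0 subrr.
  by rewrite fpsXMS SE fpsD fpsN /fexp mulrBl.
(* The equation for [Z] multiplied by [e^(u/2)], which removes the half exponents: after
   [u = ln(1+z)] only [e^u = 1+z] remains. *)
have XZS : (fexp 1 - 1) * Z =
    (fexp 1 - 1) - fpsC (1 / 2) * (fpsX C * (fexp 1 + 1)).
  have inv : fexp (1 / 2) * fexp (- (1 / 2)) = 1.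
    by rewrite -fexpD subrr; apply/esym/fexp_uniq => //; rewrite theta1 fpsC0 mul0r.
  have sq : fexp (1 / 2) * fexp (1 / 2) = fexp 1.
    by rewrite -fexpD; congr fexp; field.
  have e := congr1 (@fps_theta C) XS.
  have thN f : fps_theta (- f) = - fps_theta f.
    by apply/funext => n; rewrite fpsN /fps_theta mulrN.
  have {}e : Z * (fexp (1 / 2) - fexp (- (1 / 2))) =
      fexp (1 / 2) - fexp (- (1 / 2)) -
      fpsC (1 / 2) * (fpsX C * (fexp (1 / 2) + fexp (- (1 / 2)))).
    move: e; rewrite thetaM thetaX -[fps_theta S]opprK -ZS thetaD thN.
    rewrite !theta_fexp fpsCN -XS => e.
    transitivity (fpsX C * S - (fpsX C * S + fpsX C * - (Z * S))); first by ring.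
    by rewrite e; ring.
  have -> : (fexp 1 - 1) * Z = fexp (1 / 2) * (Z * (fexp (1 / 2) - fexp (- (1 / 2)))).
    by rewrite -sq -inv; ring.
  by rewrite e -sq -inv; ring.
have cln := ln_const0.
(* The factor [e^u - 1] becomes [z] and is cancelled. *)
have XZ : fps_comp fps_ln Z = 1 - lam * (1 + fpsC (1 / 2) * fpsX C).
  apply: fpsX_inj; have := congr1 (fps_comp fps_ln) XZS.
  rewrite !(fps_compM cln, fps_compD, fps_compN, fps_compC cln, fps_comp1 cln).
  rewrite fps_compX // fexp_ln gbin_1 addrAC subrr add0r => ->.
  have half : fpsC (1 / 2) + fpsC (1 / 2) = 1 :> fps C.
    rewrite -fpsCD; transitivity (fpsC (1%:R : C)); last exact: fpsC_nat.
    by congr fpsC; field.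
  rewrite /fps_ln; set h := fpsC _ in half *.
  transitivity (fpsX C * (1 - lam * ((h + h) + h * fpsX C))); first by ring.
  by rewrite half.
pose mu := fps_lnz (-1).
have lmu : lam * mu = 1 by rewrite -lnzS addNr.
have muE : mu = 1 + fpsC (1 / 2) * fpsX C + fps_comp fps_ln Z * mu.
  rewrite XZ; set T := 1 + _.
  transitivity (T + (mu - lam * mu * T)); last by ring.
  by rewrite lmu mul1r [RHS]addrC subrK.
rewrite ln_coefE -/mu muE !mulrDl mul1r !fpsD -[fpsC _ * _ * _]mulrA fpsCM.
rewrite -mulrA -[mu * _]/(fps_lnz (-1) * _) -ln_coefE.
congr (_ + _ + _); first by case: j => [|j]; rewrite ?fpsXM0 ?fpsXMS.
rewrite fpsM (eq_bigr (fun k : 'I_j.+1 => 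
   (\sum_(n < j.+1) fpsC (Z n) * fps_ln ^+ n) k * ln_coef C (-1) r (j - k)%N)); last first.
  by move=> k _; rewrite -fps_compE // -ltnS.
rewrite -fpsM mulr_suml fps_sum; apply: eq_bigr => n _.
rewrite -mulrA fpsCM /fps_ln exprMn -mulrA fpsXnM -ltnS ltn_ord; congr (_ * _).
rewrite !ln_coefE mulrA.
suff -> : lam ^+ n * fps_lnz (-1) = fps_lnz (n%:Z - 1) by [].
elim: (n : nat) => [|i IHi]; first by rewrite mul1r.
by rewrite exprS -mulrA IHi -lnzS -addn1 PoszD; congr fps_lnz; rewrite addrAC.
Qed.

End BinomialSeries.

(** * The values of zeta at even integers *)

Section RootsAndPowerSums.
Variable C : fieldType.

Definition fps_of_poly (p : {poly C}) : fps C := fun n => p`_n.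

Lemma fps_of_polyM : {morph fps_of_poly : p q / p * q}.
Proof. by move=> p q; apply/funext => n; rewrite /fps_of_poly coefM. Qed.

Lemma fps_of_poly_prod (ys : seq C) :
  fps_of_poly (\prod_(y <- ys) (1 - y *: 'X)) = \prod_(y <- ys) (1 - fpsC y * fpsX C).
Proof.
have one : fps_of_poly 1 = 1.
  by apply/funext => n; rewrite /fps_of_poly coef1 fps1.
rewrite (big_morph _ fps_of_polyM one); apply: eq_bigr => y _.
apply/funext => n; rewrite /fps_of_poly coefB coef1 coefZ coefX fpsD fpsN fps1.
by rewrite fpsCM.
Qed.

(** The series [\sum_y y X / (1 - y X)]; accordingly its constant coefficient is [0] and not the
    number of terms. *)
Definition power_sums (ys : seq C) : fps C :=
  fun n => if n == 0%N then 0 else \sum_(y <- ys) y ^+ n.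

(** A logarithmic derivative: the factor [1 - y X] contributes [y X / (1 - y X)], which is minus its
    [fps_theta] divided by itself. *)
Lemma newton_identities (ys : seq C) :
  power_sums ys * \prod_(y <- ys) (1 - fpsC y * fpsX C) =
  - fps_theta (\prod_(y <- ys) (1 - fpsC y * fpsX C)).
Proof.
elim: ys => [|y ys IHys].
  rewrite big_nil theta1 oppr0 mulr1; apply/funext => -[|n] //.
  by rewrite /power_sums /= big_nil.
pose g : fps C := fun n => if n == 0%N then 0 else y ^+ n.
have -> : power_sums (y :: ys) = g + power_sums ys.
  apply/funext => -[|n]; first by rewrite fpsD addr0.
  by rewrite fpsD /power_sums /= big_cons.
have gE : g * (1 - fpsC y * fpsX C) = fpsC y * fpsX C.
  rewrite mulrBr mulr1 mulrCA [g * _]mulrC.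
  apply/funext => -[|n]; rewrite fpsD fpsN !fpsCM.
    by rewrite fpsXM0 /g /fpsX /= !mulr0 subr0.
  rewrite fpsXMS /g /fpsX; case: n => [|n] /=; last by rewrite exprS subrr mulr0.
  by rewrite mulr0 subr0 mulr1.
have thE : fps_theta (1 - fpsC y * fpsX C) = - (fpsC y * fpsX C).
  apply/funext => n; rewrite fpsN fpsCM /fps_theta fpsD fpsN fps1 fpsCM /fpsX.
  by case: n => [|[|n]] /=; ring.
rewrite !big_cons thetaM thE; set P := \prod_(z <- ys) _.
transitivity (g * (1 - fpsC y * fpsX C) * P +
  (1 - fpsC y * fpsX C) * (power_sums ys * P)); first by ring.
by rewrite IHys gE; ring.
Qed.

(** Each [X - t] is [- t (1 - X / t)], and the remaining constant is the value of [p] at [0]. *)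
Lemma prod_of_roots (p : {poly C}) (ts : seq C) : size p = (size ts).+1 ->
  all (root p) ts -> uniq ts -> p`_0 = 1 ->
  p = \prod_(y <- [seq t^-1 | t <- ts]) (1 - y *: 'X).
Proof.
move=> szp rootp uts p0; rewrite -horner_coef0 in p0.
have pE := all_roots_prod_XsubC szp rootp.
rewrite uniq_rootsE in pE; move/(_ uts): pE => pE.
have nz t : t \in ts -> t != 0.
  move=> tts; apply/eqP => t0; move/allP: rootp => /(_ t tts).
  by rewrite t0 rootE p0 oner_eq0.
have {}pE : p = (lead_coef p * \prod_(t <- ts) - t) *:
    \prod_(y <- [seq t^-1 | t <- ts]) (1 - y *: 'X).
  rewrite {1}pE -scalerA big_map -scaler_prod; congr (_ *: _).
  apply: eq_big_seq => t tts; rewrite scalerBr scalerA mulNr mulfV ?nz //.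
  by rewrite scaleN1r opprK scaleNr addrC -[t%:P]mul1r mulrC mul_polyC.
set c := lead_coef p * _ in pE.
rewrite pE; suff -> : c = 1 by rewrite scale1r.
move: p0; rewrite pE hornerZ horner_prod big1 ?mulr1 // => y _.
by rewrite !hornerE ?mulr0 ?subr0.
Qed.

End RootsAndPowerSums.

Lemma big_ord_double (T : nmodType) (n : nat) (f : nat -> T) :
  \sum_(k < n.*2) f k = \sum_(j < n) (f j.*2 + f j.*2.+1).
Proof.
by elim: n => [|n IHn]; rewrite ?big_ord0 // doubleS !big_ord_recr /= IHn addrA.
Qed.

(** * The multiple-angle identity for the tangent *)

Section CotangentRoots.
Variable R : realType.
Implicit Types x t : R.

Lemma cos_sin_expr x k :
  (cos x +i* sin x)%C ^+ k = (cos (k%:R * x) +i* sin (k%:R * x))%C :> R[i].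
Proof.
elim: k => [|k IHk]; first by rewrite mul0r cos0 sin0.
rewrite exprS IHk -natr1 mulrDl mul1r [_ + x]addrC cosD sinD.
by apply/eqP; rewrite eq_complex /= eqxx addrC; apply/eqP; rewrite [cos x * _]mulrC.
Qed.

(* By de Moivre, [(1 + i tan x)^m = (1 - i tan x)^m] for [m = 2n+1]. *)
Lemma sin_multiple_root x n : cos x != 0 -> sin x != 0 ->
  sin (n.*2.+1%:R * x) = 0 ->
  \sum_(j < n.+1) (-1) ^+ j * 'C(n.*2.+1, j.*2.+1)%:R * (tan x ^+ 2) ^+ j = 0.
Proof.
move=> cx sx smx; set m := n.*2.+1; pose t : R[i] := (tan x)%:C%C * (0 +i* 1)%C.
have tne0 : t != 0.
  rewrite /t mulf_neq0 //; last by rewrite eq_complex /= oner_eq0 andbF.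
  by rewrite eq_complex /= eqxx andbT /tan mulf_neq0 // invr_eq0.
have zE s : (cos x +i* (s * sin x))%C = (cos x)%:C%C * (1 + s%:C%C * t).
  apply/eqP; rewrite eq_complex /t /tan /=; apply/andP; split; apply/eqP; field => //.
have : (1 + t) ^+ m - (1 - t) ^+ m = 0.
  have cxm : ((cos x)%:C%C : R[i]) ^+ m != 0.
    by rewrite expf_neq0 // eq_complex /= eqxx andbT.
  apply: (mulfI cxm); rewrite mulr0 mulrBr -!exprMn.
  have := zE 1; rewrite !mul1r => <-.
  have := zE (-1); rewrite rmorphN1 !mulN1r -sinN -[X in (X +i* _)%C]cosN => <-.
  by rewrite !cos_sin_expr !mulrN cosN sinN smx oppr0 subrr.
pose f k : R[i] := t ^+ k *+ 'C(m, k) - (- t) ^+ k *+ 'C(m, k).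
have -> : (1 + t) ^+ m - (1 - t) ^+ m = \sum_(k < n.+1.*2) f k.
  rewrite !exprDn -sumrB; apply: eq_bigr => k _.
  by rewrite !expr1n !mul1r.
have tt j : t ^+ j.*2 = (((-1) * tan x ^+ 2) ^+ j)%:C%C.
  rewrite -muln2 mulnC exprM [RHS]rmorphXn; congr (_ ^+ _).
  by apply/eqP; rewrite eq_complex /=; apply/andP; split; apply/eqP; ring.
rewrite big_ord_double.
(* Terms of even degree cancel and those of odd degree double, so [2 t] splits off and leaves a real
   polynomial in [tan x ^+ 2]. *)
have -> : \sum_(j < n.+1) (f j.*2 + f j.*2.+1) = (t + t) * (\sum_(j < n.+1)
    (-1) ^+ j * 'C(m, j.*2.+1)%:R * (tan x ^+ 2) ^+ j)%:C%C.
  rewrite raddf_sum mulr_sumr; apply: eq_bigr => j _.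
  have ev : (- t) ^+ j.*2 = t ^+ j.*2.
    by rewrite exprNn -signr_odd odd_double expr0 mul1r.
  rewrite /f [t ^+ _.+1]exprS [(- t) ^+ _.+1]exprS ev subrr add0r.
  rewrite mulNr mulNrn opprK -mulrnDl -mulrDl tt -mulrnAr; congr (_ * _).
  by rewrite -rmorphMn exprMn mulrAC mulr_natr.
move/eqP; rewrite mulf_eq0 -mulr2n mulrn_eq0 /= (negPf tne0) /=.
by rewrite eq_complex /= eqxx andbT => /eqP.
Qed.

End CotangentRoots.

(** * Power sums of cotangents and zeta at even integers *)

Section ZetaRecurrence.
Variable R : realType.
Implicit Types (F G : nat -> fps R) (f g : fps R).

Lemma cvg_sum_seq (J : Type) (r : seq J) (u : J -> nat -> R) (l : J -> R) :
  (forall j, u j n @[n --> \oo] --> l j) ->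
  (\sum_(j <- r) u j n) @[n --> \oo] --> \sum_(j <- r) l j.
Proof.
move=> ul; elim: r => [|j r IHr].
  by under eq_fun do rewrite big_nil; rewrite big_nil; exact: cvg_cst.
under eq_fun do rewrite big_cons; rewrite big_cons.
by apply: cvgD; [exact: ul | exact: IHr].
Qed.

Lemma cvg_expr (u : nat -> R) (l : R) k :
  u n @[n --> \oo] --> l -> (u n ^+ k) @[n --> \oo] --> l ^+ k.
Proof.
move=> ul; elim: k => [|k IHk].
  by under eq_fun do rewrite expr0; rewrite expr0; exact: cvg_cst.
by under eq_fun do rewrite exprS; rewrite exprS; exact: cvgM.
Qed.

Definition fps_cvg F g := forall j, F n j @[n --> \oo] --> g j.

Lemma fps_cvgM F f G g : fps_cvg F f -> fps_cvg G g ->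
  fps_cvg (fun n => F n * G n) (f * g).
Proof.
by move=> Ff Gg j; apply: cvg_sum_seq => i; apply: cvgM; [exact: Ff | exact: Gg].
Qed.

Lemma fps_cvg_inv F f : fps_cvg F f -> fps_cvg (fun n => ps_inv (F n)) (ps_inv f).
Proof.
move=> Ff j; apply: cvg_sum_seq => k; rewrite /=.
suff H : fps_cvg (fun n => (1 - F n) ^+ k) ((1 - f) ^+ k).
  by move: (H j); under eq_fun do rewrite -ps_expE; rewrite -ps_expE.
elim: (k : nat) => [|i IHi]; first by move=> l; exact: cvg_cst.
under eq_fun do rewrite exprS; rewrite exprS; apply: fps_cvgM => // l.
by apply: cvgB; [exact: cvg_cst | exact: Ff].
Qed.

Lemma fps_cvg_theta F f : fps_cvg F f ->
  fps_cvg (fun n => fps_theta (F n)) (fps_theta f).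
Proof. by move=> Ff j; apply: cvgMr; exact: Ff. Qed.

Definition mesh n : R := pi / n.*2.+1%:R.

Definition cot_squares n : seq R :=
  [seq (mesh n / tan (k%:R * mesh n)) ^+ 2 | k <- iota 1 n].

(** The polynomial of [sin_multiple_root] in the variable [(tan x / mesh n) ^+ 2], divided by [2n+1]
    so that its constant term is [1]. *)
Definition cot_coef n : fps R :=
  fun j => (-1) ^+ j * mesh n ^+ j.*2 * 'C(n.*2.+1, j.*2.+1)%:R / n.*2.+1%:R.

Lemma mesh_gt0 n : 0 < mesh n.
Proof. by rewrite divr_gt0 ?pi_gt0 // ltr0n. Qed.

Lemma mesh_bounds n k : k \in iota 1 n -> 0 < k%:R * mesh n < pi / 2.
Proof.
rewrite mem_iota => /andP[k_gt0 k_le]; apply/andP; split.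
  by rewrite mulr_gt0 ?mesh_gt0 // ltr0n.
rewrite /mesh mulrCA ltr_pM2l ?pi_gt0 // ltr_pdivrMr ?ltr0n //.
rewrite mulrC ltr_pdivlMr ?ltr0n // -natrM ltr_nat; lia.
Qed.

Lemma sin_nat_pi k : sin (k%:R * pi) = 0 :> R.
Proof. by elim: k => [|k IHk]; rewrite ?mul0r ?sin0 // -natr1 mulrDl mul1r sinDpi IHk oppr0. Qed.

(** The polynomial has degree [n], and its [n] roots are distinct because the tangent is positive
    and injective on the angles [k%:R * mesh n], all below [pi / 2]. *)
Lemma cot_squares_prod n :
  \prod_(y <- cot_squares n) (1 - fpsC y * fpsX R) = cot_coef n.
Proof.
pose p := \poly_(j < n.+1) cot_coef n j.
pose ts := [seq (tan (k%:R * mesh n) / mesh n) ^+ 2 | k <- iota 1 n].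
have m0 : mesh n != 0 by rewrite gt_eqF ?mesh_gt0.
have tan_gt0 k : k \in iota 1 n -> 0 < tan (k%:R * mesh n).
  move=> /mesh_bounds/andP[x0 xpi]; rewrite divr_gt0 ?sin_gt0_pihalf ?x0 //.
  by rewrite cos_gt0_pihalf // xpi (lt_trans _ x0) // oppr_lt0 divr_gt0 ?pi_gt0.
have -> : cot_squares n = [seq t^-1 | t <- ts].
  rewrite -map_comp; apply/eq_in_map => k kn /=.
  by rewrite -[RHS]exprVn [in RHS]invf_div.
rewrite -fps_of_poly_prod -(@prod_of_roots _ p).
- apply/funext => j; rewrite /fps_of_poly coef_poly; case: ltnP => // lt_nj.
  by rewrite /cot_coef bin_small ?mulr0 ?mul0r //; lia.
- rewrite size_map size_iota size_poly_eq // /cot_coef binn mulr1.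
  by rewrite !mulf_neq0 ?signr_eq0 ?expf_neq0 ?invr_eq0 ?pnatr_eq0.
- apply/allP => _ /mapP[k kn ->]; apply/eqP; rewrite horner_poly.
  have /andP[x0 xpi] := mesh_bounds kn.
  have sx : 0 < sin (k%:R * mesh n) by rewrite sin_gt0_pihalf ?x0.
  have cx : 0 < cos (k%:R * mesh n).
    by rewrite cos_gt0_pihalf // xpi (lt_trans _ x0) // oppr_lt0 divr_gt0 ?pi_gt0.
  have root : sin (n.*2.+1%:R * (k%:R * mesh n)) = 0.
    by rewrite /mesh mulrCA [_ * (pi / _)]mulrC divfK ?pnatr_eq0 // sin_nat_pi.
  have := sin_multiple_root (lt0r_neq0 cx) (lt0r_neq0 sx) root.
  move/(congr1 (fun x => x / n.*2.+1%:R)); rewrite mul0r; apply: etrans.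
  rewrite mulr_suml; apply: eq_bigr => j _.
  have e : mesh n ^+ j.*2 * ((tan (k%:R * mesh n) / mesh n) ^+ 2) ^+ j =
      (tan (k%:R * mesh n) ^+ 2) ^+ j.
    by rewrite -muln2 mulnC exprM -!exprMn mulrC divfK.
  by rewrite /cot_coef -e; ring.
- rewrite map_inj_in_uniq ?iota_uniq // => k l kn ln /eqP.
  rewrite eqrXn2 //; try by rewrite divr_ge0 ?ltW ?tan_gt0 ?mesh_gt0.
  rewrite (inj_eq (mulIf _)) ?invr_eq0 // => /eqP /tan_inj.
  have H i : i \in iota 1 n -> i%:R * mesh n \in `](- (pi / 2)), (pi / 2)[%R.
    move=> /mesh_bounds/andP[x0 xpi]; rewrite in_itv /= xpi andbT.
    by rewrite (lt_trans _ x0) // oppr_lt0 divr_gt0 ?pi_gt0.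
  by move=> /(_ (H _ kn) (H _ ln)) /(mulIf m0) /eqP; rewrite eqr_nat => /eqP.
- by rewrite coef_poly /= /cot_coef bin1 expr0 !mul1r divff ?pnatr_eq0.
Qed.


Lemma mesh_cvg0 : mesh n @[n --> \oo] --> (0 : R).
Proof.
have H : (pi * (@harmonic R n)) @[n --> \oo] --> (0 : R).
  by rewrite -[X in _ --> X](mulr0 pi); apply: cvgMr; exact: cvg_harmonic.
apply: (@squeeze_cvgr _ _ _ _ (fun=> 0) (fun n => pi * @harmonic R n));
  [|exact: cvg_cst|exact: H]; near=> n.
rewrite ltW ?mesh_gt0 //= /mesh /harmonic /= ler_pM2l ?pi_gt0 //.
by rewrite lef_pV2 ?posrE ?ltr0n // ler_nat; lia.
Unshelve. all: by end_near. Qed.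

(* the Taylor coefficients of [sin (pi sqrt X) / (pi sqrt X)] *)
Definition sinc_coef : fps R := fun j => (-1) ^+ j * pi ^+ j.*2 / j.*2.+1`!%:R.

Lemma natr_subn_bin m k : k.+2%:R * 'C(m, k.+2)%:R =
  'C(m, k.+1)%:R * (m%:R - k.+1%:R) :> R.
Proof.
case: (ltnP m k.+1) => [lt_mk|le_km].
  by rewrite !bin_small ?mulr0 ?mul0r //; lia.
by rewrite -natrB // -!natrM; congr _%:R; rewrite mul_bin_left mulnC.
Qed.

Lemma cvg_binomial_ratio k :
  ('C(n.*2.+1, k.+1)%:R / n.*2.+1%:R ^+ k.+1) @[n --> \oo] --> (k.+1`!%:R^-1 : R).
Proof.
elim: k => [|k IHk].
  rewrite invr1; under eq_fun do rewrite bin1 expr1 divff ?pnatr_eq0 //.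
  exact: cvg_cst.
(* Ratio of consecutive binomials; [k.+1%:R / pi * mesh n] is [k.+1%:R / n.*2.+1%:R], written
   through [mesh] to use its limit. *)
have -> : (fun n => 'C(n.*2.+1, k.+2)%:R / n.*2.+1%:R ^+ k.+2 : R) =
  (fun n => 'C(n.*2.+1, k.+1)%:R / n.*2.+1%:R ^+ k.+1 *
    ((1 - k.+1%:R / pi * mesh n) / k.+2%:R)).
  apply/funext => n; apply: (mulfI (natrS_neq0 _ k.+1)).
  rewrite mulrA natr_subn_bin /mesh [_ ^+ k.+2]exprS.
  move: (lt0r_neq0 (pi_gt0 R)); generalize (pi : R) => p p0; field.
  by rewrite p0 -(natrD _ 2 k) nat1r expf_neq0 ?pnatr_eq0.
have -> : k.+2`!%:R^-1 = k.+1`!%:R^-1 * ((1 - k.+1%:R / pi * 0) / k.+2%:R) :> R.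
  by rewrite factS natrM invfM mulr0 subr0 mul1r mulrC.
apply: cvgM => //; apply: cvgMl; apply: cvgB; first exact: cvg_cst.
by apply: cvgMr; exact: mesh_cvg0.
Qed.

Lemma cot_coef_cvg : fps_cvg cot_coef sinc_coef.
Proof.
move=> j; have -> : cot_coef ^~ j = (fun n => (-1) ^+ j * pi ^+ j.*2 *
    ('C(n.*2.+1, j.*2.+1)%:R / n.*2.+1%:R ^+ j.*2.+1)).
  apply/funext => n; rewrite /cot_coef /mesh exprMn exprVn [_ ^+ j.*2.+1]exprS.
  by rewrite invfM; ring.
by apply: cvgMr; exact: cvg_binomial_ratio.
Qed.

(** Minus the logarithmic derivative of [sin(pi sqrt X) / (pi sqrt X)], the formal limit of the
    quotients in Newton's identities. *)
Definition zeta_series : fps R := - fps_theta sinc_coef * ps_inv sinc_coef.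

Lemma zeta_seriesE : zeta_series * sinc_coef = - fps_theta sinc_coef.
Proof.
rewrite /zeta_series -mulrA [X in _ * X = _]mulrC ps_invE ?mulr1 //.
by rewrite /sinc_coef !expr0 !mul1r invr1.
Qed.

(** Newton's identities express the power sums by the coefficients alone, and product, inverse and
    [fps_theta] are continuous in each coefficient. *)
Lemma power_sums_cvg : fps_cvg (fun n => power_sums (cot_squares n)) zeta_series.
Proof.
have -> : (fun n => power_sums (cot_squares n)) =
    (fun n => - fps_theta (cot_coef n) * ps_inv (cot_coef n)).
  apply/funext => n; rewrite -cot_squares_prod -newton_identities -mulrA.
  rewrite ps_invE ?mulr1 // cot_squares_prod.
  by rewrite /cot_coef expr0 !mul1r bin1 divff ?pnatr_eq0.
apply: fps_cvgM; last exact/fps_cvg_inv/cot_coef_cvg.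
by move=> j; apply: cvgN; exact/fps_cvg_theta/cot_coef_cvg.
Qed.

(** From [x cos x <= sin x <= x] one gets [cot x <= 1/x <= 1/sin x], and
    [1/sin^2 x = 1 + cot^2 x]. *)
Lemma cot_bounds (x : R) : 0 < x < pi / 2 ->
  (tan x)^-1 ^+ 2 <= x^-1 ^+ 2 <= 1 + (tan x)^-1 ^+ 2.
Proof.
move=> /andP[x0 xpi].
have sx : 0 < sin x by rewrite sin_gt0_pihalf ?x0.
have cx : 0 < cos x.
  by rewrite cos_gt0_pihalf // xpi (lt_trans _ x0) // oppr_lt0 divr_gt0 ?pi_gt0.
have xpi' : x <= pi.
  by rewrite (le_trans (ltW xpi)) // ler_pdivrMr // ler_peMr ?pi_ge0 // ler1n.
(* This gives [sin x = x cos c] with [c] between [0] and [x]; both bounds on [sin x] come from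
   [cos x <= cos c <= 1]. *)
have [c] := @MVT_segment R sin cos 0 x (ltW x0)
  (fun y _ => is_derive_sin y) (continuous_subspaceT (@continuous_sin R)).
rewrite in_itv /= sin0 !subr0 => /andP[c0 cx' sE].
have ge : x * cos x <= sin x.
  rewrite sE mulrC ler_wpM2r ?(ltW x0) //.
  move: cx'; rewrite le_eqVlt => /predU1P[->//|lt_cx]; apply/ltW.
  by rewrite ltr_cos // in_itv /= ?c0 ?(ltW x0) // ltW // (lt_le_trans lt_cx).
have le : sin x <= x by rewrite sE ler_piMl ?(ltW x0) // cos_le1.
have tx : (tan x)^-1 = cos x / sin x by rewrite /tan invf_div.
have -> : 1 + (tan x)^-1 ^+ 2 = (sin x)^-1 ^+ 2.
  rewrite tx expr_div_n -[1](@divff _ (sin x ^+ 2)) ?expf_neq0 ?gt_eqF //.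
  by rewrite -mulrDl addrC cos2Dsin2 mul1r exprVn.
have le1 : (tan x)^-1 <= x^-1.
  by rewrite tx ler_pdivrMr // mulrC ler_pdivlMr // mulrC.
have le2 : x^-1 <= (sin x)^-1 by rewrite lef_pV2.
have t0 : 0 < (tan x)^-1 by rewrite tx divr_gt0.
by apply/andP; split; rewrite lerXn2r // nnegrE ?invr_ge0 ltW // -invr_gt0.
Qed.

Lemma cot_square_bounds n k : k \in iota 1 n ->
  (mesh n / tan (k%:R * mesh n)) ^+ 2 <= k%:R ^- 2 <=
  mesh n ^+ 2 + (mesh n / tan (k%:R * mesh n)) ^+ 2.
Proof.
move=> kn; have /cot_bounds := mesh_bounds kn.
have m2 : 0 < mesh n ^+ 2 by rewrite exprn_gt0 ?mesh_gt0.
have -> : k%:R ^- 2 = mesh n ^+ 2 * (k%:R * mesh n)^-1 ^+ 2.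
  by rewrite -exprMn [in RHS]invfM mulrCA mulfV ?mulr1 ?exprVn // gt_eqF ?mesh_gt0.
have e t : mesh n ^+ 2 + mesh n ^+ 2 * t = mesh n ^+ 2 * (1 + t).
  by rewrite mulrDr mulr1.
by rewrite [(mesh n / _) ^+ 2]exprMn e !ler_pM2l.
Qed.

(** These sums bound the error terms in the expansion of [(mesh n ^+ 2 + y) ^+ j.+1]. For [i > 0]
    the power sum converges; for [i = 0] it equals [n], and [mesh n ^+ 2 * n <= pi * mesh n]. *)
Lemma cvg_mesh_sum i :
  (mesh n ^+ 2 * \sum_(y <- cot_squares n) y ^+ i) @[n --> \oo] --> (0 : R).
Proof.
have mesh2 : (mesh n ^+ 2) @[n --> \oo] --> (0 : R).
  by have := cvg_expr (k := 2) mesh_cvg0; rewrite expr0n.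
case: i => [|i]; last first.
  rewrite -[X in _ --> X](mul0r (zeta_series i.+1)); apply: cvgM => //.
  exact: (@power_sums_cvg i.+1).
have szE (ys : seq R) : \sum_(y <- ys) y ^+ 0 = (size ys)%:R.
  by elim: ys => [|y ys IHys]; rewrite ?big_nil // big_cons IHys expr0 nat1r.
have H : (pi * mesh n) @[n --> \oo] --> (0 : R).
  by rewrite -[X in _ --> X](mulr0 pi); apply: cvgMr; exact: mesh_cvg0.
apply: (@squeeze_cvgr _ _ _ _ (fun=> 0) (fun n => pi * mesh n));
  [|exact: cvg_cst|exact: H]; near=> n.
rewrite szE size_map size_iota.
rewrite mulr_ge0 ?sqr_ge0 ?ler0n //= expr2 -mulrA mulrC ler_wpM2r ?(ltW (mesh_gt0 _)) //.
rewrite /mesh mulrAC ler_pdivrMr ?ltr0n // ler_wpM2l ?pi_ge0 // ler_nat; lia.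
Unshelve. all: by end_near. Qed.

(* Summing [cot^2 x <= 1/x^2 <= 1 + cot^2 x] over [x = k pi / (2n+1)] squeezes
   the partial sums of zeta between two power sums with the same limit. *)
Lemma cvg_zeta_series j :
  series (fun n : nat => (n.+1%:R : R) ^- (2 * j.+1)) n @[n --> \oo]
    --> zeta_series j.+1.
Proof.
pose up n : R := \sum_(y <- cot_squares n) (mesh n ^+ 2 + y) ^+ j.+1.
have up_cvg : up n @[n --> \oo] --> zeta_series j.+1.
  (* Binomial expansion of the upper sum: the term [i = j.+1] is the power sum itself, all others
     carry a factor [mesh n ^+ 2] and vanish in the limit. *)
  pose u i n := mesh n ^+ 2 ^+ (j.+1 - i) * (\sum_(y <- cot_squares n) y ^+ i)
    * 'C(j.+1, i)%:R.
  have -> : up = (fun n => \sum_(i <- enum 'I_j.+2) u i n).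
    apply/funext => n; rewrite /up /u.
    under eq_bigr do rewrite exprDn; rewrite exchange_big /= big_enum /=.
    apply: eq_bigr => i _; rewrite mulr_sumr mulr_suml.
    by apply: eq_bigr => y _; rewrite mulr_natr.
  have -> : zeta_series j.+1 =
      \sum_(i <- enum 'I_j.+2) (if (i == j.+1 :> nat) then zeta_series j.+1 else 0).
    rewrite big_enum /= big_ord_recr /= eqxx big1 ?add0r // => i _.
    by rewrite ltn_eqF.
  apply: (@cvg_sum_seq _ _ (fun (i : 'I_j.+2) n => u i n)) => i.
  case: ifPn => [/eqP ij|neq_ij].
    rewrite /u; under eq_fun do rewrite ij subnn expr0 mul1r binn mulr1.
    exact: (@power_sums_cvg j.+1).
  have lt_ij : (i < j.+1)%N by rewrite ltn_neqAle neq_ij -ltnS ltn_ord.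
  have -> : u i = (fun n => (mesh n ^+ 2) ^+ (j - i) *
      (mesh n ^+ 2 * \sum_(y <- cot_squares n) y ^+ i) * 'C(j.+1, i)%:R).
    by apply/funext => n; rewrite /u subSn // exprSr -[X in X * _]mulrA.
  rewrite -[X in _ --> X](mul0r ('C(j.+1, i)%:R)) -[X in X * _](mulr0 (0 ^+ (j - i))).
  apply: cvgMl; apply: cvgM; last exact: cvg_mesh_sum.
  by apply: cvg_expr; have := cvg_expr (k := 2) mesh_cvg0; rewrite expr0n.
apply: (@squeeze_cvgr _ _ _ _ (fun n => power_sums (cot_squares n) j.+1) up);
  [|exact: (@power_sums_cvg j.+1)|exact: up_cvg]; near=> n.
have -> : series (fun n : nat => (n.+1%:R : R) ^- (2 * j.+1)) n =
    \sum_(k <- iota 1 n) (k%:R ^- 2) ^+ j.+1.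
  rewrite /series /= /index_iota subn0 -[iota 1 n]/(iota (1 + 0) n) iotaDl big_map.
  by apply: eq_bigr => k _; rewrite -exprVn -exprM exprVn add1n.
rewrite /power_sums /up /= !big_map; apply/andP; split.
- rewrite big_seq [leRHS]big_seq; apply: ler_sum => k /cot_square_bounds/andP[le1 _].
  by rewrite lerXn2r ?nnegrE ?sqr_ge0 // invr_ge0 sqr_ge0.
- rewrite big_seq [leRHS]big_seq; apply: ler_sum => k /cot_square_bounds/andP[_ le2].
  by rewrite lerXn2r ?nnegrE ?addr_ge0 ?sqr_ge0 // invr_ge0 sqr_ge0.
Unshelve. all: by end_near. Qed.

Lemma zetaE j : zeta R (2 * j.+1) = zeta_series j.+1.
Proof. by apply: cvg_lim => //; exact: cvg_zeta_series. Qed.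

End ZetaRecurrence.

Section EvenSeries.
Variable C : fieldType.

Lemma fpsXnE k n : (fpsX C ^+ k) n = (n == k)%:R.
Proof.
rewrite -[_ ^+ k]mulr1 fpsXnM fps1.
by case: leqP => [le_kn|lt_nk]; [congr (_%:R); lia | rewrite ltn_eqF].
Qed.

Lemma fps_comp_even (f : fps C) n :
  fps_comp (fpsX C ^+ 2) f n = if odd n then 0 else f n./2.
Proof.
rewrite /fps_comp; under eq_bigr do rewrite -exprM fpsXnE.
case: ifPn => [odd_n|even_n].
  apply: big1 => j _; case: eqP => [e|_]; rewrite ?mulr0 //.
  by have : ~~ odd n; [rewrite {1}e oddM | rewrite odd_n].
have lt_h : (n./2 < n.+1)%N by lia.
rewrite (bigD1 (Ordinal lt_h)) //= big1 ?addr0.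
  by rewrite mul2n even_halfK // eqxx mulr1.
move=> j /eqP ne_j; case: eqP => [e|_]; rewrite ?mulr0 //.
by case: ne_j; apply/val_inj => /=; lia.
Qed.

End EvenSeries.

(** * Transfer of the zeta values to complex series *)

Section ComplexZeta.
Variable R : realType.
Local Notation C := R[i].

(** The series [1 - (u/2) coth(u/2)], as [zeta_sinhc] will show. The powers of [2 pi i] are those
    that normalize the modes [a[n]]. *)
Definition zeta_even_series : fps C := fun n =>
  if (n == 0%N) || odd n then 0 else 2%:R * ((zeta R n)%:C)%C / two_pi_i R ^+ n.

Definition sinhc_series : fps C :=
  fun n => ((1 / 2) ^+ n.+1 - (- (1 / 2)) ^+ n.+1) / n.+1`!%:R.

Lemma two_pi_i_neq0 : two_pi_i R != 0.
Proof.
by rewrite eq_complex /= eqxx /= mulf_neq0 ?pnatr_eq0 // gt_eqF ?pi_gt0.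
Qed.

Lemma two_pi_iX2 j : two_pi_i R ^+ j.*2 = (((-4) * pi ^+ 2) ^+ j)%:C%C.
Proof.
rewrite -muln2 mulnC exprM [RHS]rmorphXn; congr (_ ^+ _).
by apply/eqP; rewrite eq_complex /=; apply/andP; split; apply/eqP; ring.
Qed.

(** The substitution [X = (u / (2 pi i))^2], recorded in powers of [u^2]; it turns
    [sin(pi sqrt X) / (pi sqrt X)] into [2 sinh(u/2) / u]. *)
Let scale (f : fps R) : fps C := fun j => ((f j)%:C)%C / two_pi_i R ^+ j.*2.

Let scaleM f g : scale (f * g) = scale f * scale g.
Proof.
apply/funext => n; rewrite /scale !fpsM rmorph_sum mulr_suml.
apply: eq_bigr => i _; have le_in : (i <= n)%N by rewrite -ltnS.
rewrite (_ : n.*2 = i.*2 + (n - i).*2)%N; last by rewrite -doubleD subnKC.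
by rewrite exprD invfM rmorphM /= mulrACA.
Qed.

(** Image of [zeta_seriesE] under the substitution. As [X] is proportional to [u^2], the Euler
    operator in [u] is twice the one in [X]; hence the factor [2] in [zeta_even_series]. *)
Lemma zeta_sinhc : zeta_even_series * sinhc_series = - fps_theta sinhc_series.
Proof.
have X20 : (fpsX C ^+ 2) 0%N = 0 by rewrite fpsXnE.
have SE : sinhc_series = fps_comp (fpsX C ^+ 2) (scale (sinc_coef R)).
  apply/funext => n; rewrite fps_comp_even /sinhc_series mul1r exprNn -signr_odd /=.
  case: (boolP (odd n)) => [odd_n|even_n] /=; first by rewrite expr0 mul1r subrr mul0r.
  rewrite expr1 mulN1r opprK /scale /sinc_coef even_halfK // -(even_halfK even_n).
  rewrite two_pi_iX2 doubleK; move: (n./2) => k.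
  have -> : 2^-1 ^+ k.*2.+1 + 2^-1 ^+ k.*2.+1 = (((4 ^+ k)^-1 : R)%:C)%C.
    rewrite exprS -mulrDl.
    have -> : 2^-1 + 2^-1 = 1 :> C by field.
    rewrite mul1r -muln2 mulnC exprM -exprVn rmorphXn; congr (_ ^+ _).
    by rewrite fmorphV rmorph_nat; field.
  have -> : k.*2.+1`!%:R = ((k.*2.+1`!%:R : R)%:C)%C by rewrite rmorph_nat.
  rewrite -!fmorph_div; congr (_%:C)%C.
  have p0 := lt0r_neq0 (pi_gt0 R); have f0 := factr_neq0 R k.*2.+1.
  have -> : (-4) * pi ^+ 2 = (-1) * 4 * pi ^+ 2 :> R by ring.
  rewrite -[in pi ^+ _.*2]muln2 [(k * 2)%N]mulnC exprM !exprMn.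
  have x0 := expf_neq0 k p0; have y0 : (4 : R) ^+ k != 0 by rewrite expf_neq0.
  have z0 : (-1 : R) ^+ k != 0 by rewrite signr_eq0.
  move: (pi ^+ k) (4 ^+ k) ((-1) ^+ k) (k.*2.+1`!%:R) x0 y0 z0 f0 => x y z t x0 y0 z0 t0.
  by field; rewrite x0 y0 z0 t0.
have ZE : zeta_even_series = 2%:R * fps_comp (fpsX C ^+ 2) (scale (zeta_series R)).
  apply/funext => n; rewrite -fpsC_nat fpsCM fps_comp_even /zeta_even_series.
  case: n => [|n] /=.
    rewrite /scale /zeta_series fpsM big_ord1 fpsN /fps_theta mul0r oppr0 mul0r.
    by rewrite mul0r mulr0.
  case: ifPn => [_|even_n]; first by rewrite mulr0.
  have e : n.+1 = (n.+1)./2.*2 by rewrite even_halfK.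
  rewrite -mulrA; congr (_ * _); rewrite /scale -e; congr (_%:C%C / _).
  have {}e : n.+1 = (2 * uphalf n)%N by rewrite {1}e mul2n.
  by case: (uphalf n) e => [|j] e //; rewrite e zetaE.
have comp := fps_compM X20.
rewrite ZE SE theta_comp // -mulrA -comp -scaleM zeta_seriesE.
have -> : fps_theta (fpsX C ^+ 2) = 2%:R * fpsX C ^+ 2.
  by rewrite thetaXn thetaX expr1 expr2 mulrA.
rewrite mulrCA -mulrN; congr (_ * _).
rewrite -[X in _ = - (_ * X)](fps_compX X20) -comp -fps_compN; congr fps_comp; apply/funext => -[|j].
  by rewrite fpsN mulrC fpsXM0 oppr0 /scale fpsN /fps_theta mul0r oppr0 raddf0 mul0r.
rewrite fpsN mulrC fpsXMS /scale /fps_deriv fpsN /fps_theta rmorphN rmorphM /=.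
by rewrite rmorph_nat mulNr mulrA.
Qed.

End ComplexZeta.

(** * Traces *)

Section Traces.
Variable C : fieldType.

Lemma linear_combination (U U' : lmodType C) (f : U -> U') d (k : 'I_d -> C) (x : 'I_d -> U) :
  linear f -> f (\sum_i k i *: x i) = \sum_i k i *: f (x i).
Proof.
move=> lin_f.
pose F : {linear U -> U'} := HB.pack f (GRing.isLinear.Build _ _ _ _ f lin_f).
rewrite -[f]/(F : U -> U') linear_sum; apply: eq_bigr => i _.
by rewrite linearZ.
Qed.

Lemma subspace_combination (U : lmodType C) (S : set U) d (k : 'I_d -> C) (x : 'I_d -> U) :
  Defs.subspace S -> (forall i, S (x i)) -> S (\sum_i k i *: x i).
Proof.
move=> [S0 SD] Sx; apply: (big_ind S) => // [y z Sy Sz|i _].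
  by rewrite -[y]scale1r; exact: SD.
by rewrite -[_ *: _]addr0; exact: SD.
Qed.

Lemma basis_coordinates (U U' : lmodType C) (S : set U) d (b : 'I_d -> U) d' (x : 'I_d' -> U) :
  is_basis S b -> (forall j, S (x j)) ->
  exists P : 'M[C]_(d, d'), forall j, x j = \sum_i P i j *: b i.
Proof.
move=> [_ basis_b] Sx.
have /choice[k kE] : forall j, exists k : 'rV[C]_d, x j = \sum_i k 0 i *: b i.
  by move=> j; have [k [kE _]] := basis_b _ (Sx j); exists k.
exists (\matrix_(i, j) k j 0 i) => j; rewrite kE.
by apply: eq_bigr => i _; rewrite mxE.
Qed.

Lemma basis_coordinates_inj (U : lmodType C) (S : set U) d (b : 'I_d -> U) d'
    (P Q : 'M[C]_(d, d')) : Defs.subspace S -> is_basis S b ->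
  (forall j, \sum_i P i j *: b i = \sum_i Q i j *: b i) -> P = Q.
Proof.
move=> subS [Sb basis_b] PQ; apply/matrixP => i j.
have [k [_ k_uniq]] := basis_b _ (subspace_combination (P ^~ j) subS Sb).
have kP : k = \row_l P l j.
  by apply: k_uniq; apply: eq_bigr => l _; rewrite mxE.
have kQ : k = \row_l Q l j.
  by apply: k_uniq; rewrite PQ; apply: eq_bigr => l _; rewrite mxE.
by have := congr1 (fun r : 'rV_d => r 0 i) (etrans (esym kP) kQ); rewrite !mxE.
Qed.

Section Swap.
Variables (U U' : lmodType C) (S : set U) (S' : set U') (A : U -> U') (B : U' -> U).
Hypotheses (subS : Defs.subspace S) (subS' : Defs.subspace S') (linA : linear A) (linB : linear B).
Hypotheses (AS : forall x, S x -> S' (A x)) (BS : forall y, S' y -> S (B y)).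

(** In bases of [S] and [S'] the maps become rectangular matrices [Q] and [T], and the traces are
    those of [T *m Q] and [Q *m T]. *)
Lemma is_trace_swap t t' : is_trace S (B \o A) t -> is_trace S' (A \o B) t' -> t = t'.
Proof.
move=> [d [b [P [bS BA ->]]]] [d' [b' [P' [bS' AB ->]]]].
have [Q QE] := basis_coordinates U bS' (fun j => AS (bS.1 j)).
have [T TE] := basis_coordinates U bS (fun j => BS (bS'.1 j)).
have -> : P = T *m Q.
  apply: (basis_coordinates_inj subS bS) => j; rewrite -BA /= QE linear_combination //.
  transitivity (\sum_i \sum_l (T l i * Q i j) *: b l).
    by apply: eq_bigr => i _; rewrite TE scaler_sumr; apply: eq_bigr => l _;
      rewrite scalerA mulrC.
  by rewrite exchange_big; apply: eq_bigr => l _ /=; rewrite mxE scaler_suml.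
have -> : P' = Q *m T.
  apply: (basis_coordinates_inj subS' bS') => j; rewrite -AB /= TE linear_combination //.
  transitivity (\sum_i \sum_l (Q l i * T i j) *: b' l).
    by apply: eq_bigr => i _; rewrite QE scaler_sumr; apply: eq_bigr => l _;
      rewrite scalerA mulrC.
  by rewrite exchange_big; apply: eq_bigr => l _ /=; rewrite mxE scaler_suml.
exact: mxtrace_mulC.
Qed.

End Swap.

Lemma trace_on_ext (U : lmodType C) (S : set U) (A B : U -> U) :
  (forall x, S x -> A x = B x) -> trace_on S A = trace_on S B.
Proof.
move=> AB; congr xget; apply/funext => t; apply/propext.
by split=> -[d [b [P [bS AE ->]]]]; exists d, b, P; split=> // j;
  rewrite -AE AB //; exact: bS.1.
Qed.

Definition preserves (U : lmodType C) (S : set U) (A : U -> U) : Prop :=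
  linear A /\ forall x, S x -> S (A x).

Section TraceOn.
Variables (U : lmodType C) (S : set U).
Hypotheses (subS : Defs.subspace S) (finS : finite_dim S).

(** The swap with [B = id] compares two bases of the same subspace. *)
Lemma is_trace_uniq A t t' : preserves S A -> is_trace S A t -> is_trace S A t' -> t = t'.
Proof.
move=> [linA AS] tr tr'.
by apply: (is_trace_swap subS subS linA (B := id)) tr tr'.
Qed.

Lemma trace_onE A t : preserves S A -> is_trace S A t -> trace_on S A = t.
Proof. by move=> SA tr; apply: (is_trace_uniq SA _ tr); apply: xgetPex; exists t. Qed.

Lemma trace_onP A : preserves S A -> is_trace S A (trace_on S A).
Proof.
move=> [linA AS]; have [d [b bS]] := finS.
have [P PE] := basis_coordinates U bS (fun j => AS _ (bS.1 j)).
by apply: xgetPex; exists (\tr P), d, b, P.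
Qed.

Lemma preserves_lin k A B : preserves S A -> preserves S B ->
  preserves S (fun x => k *: A x + B x).
Proof.
move=> [linA AS] [linB BS]; split=> [c x y|x Sx]; last by apply: subS.2; [exact: AS | exact: BS].
rewrite linA linB !scalerDr !scalerA [k * c]mulrC addrACA; congr (_ + _ + _).
Qed.

Lemma trace_on_lin k A B : preserves S A -> preserves S B ->
  trace_on S (fun x => k *: A x + B x) = k * trace_on S A + trace_on S B.
Proof.
move=> SA SB; apply: trace_onE; first exact: preserves_lin.
have [d [b bS]] := finS.
have [P PE] := basis_coordinates U bS (fun j => SA.2 _ (bS.1 j)).
have [Q QE] := basis_coordinates U bS (fun j => SB.2 _ (bS.1 j)).
have -> : trace_on S A = \tr P by apply: trace_onE => //; exists d, b, P.
have -> : trace_on S B = \tr Q by apply: trace_onE => //; exists d, b, Q.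
exists d, b, (k *: P + Q); split=> //; last by rewrite mxtraceD mxtraceZ.
move=> j; rewrite PE QE scaler_sumr -big_split; apply: eq_bigr => i _ /=.
by rewrite !mxE scalerDl scalerA.
Qed.

Lemma preserves0 : preserves S (fun=> 0).
Proof. by split=> [c x y|x _]; [rewrite scaler0 addr0 | exact: subS.1]. Qed.

Lemma trace_on0 A : (forall x, S x -> A x = 0) -> trace_on S A = 0.
Proof.
move=> A0; rewrite (@trace_on_ext _ S A (fun=> 0)) //.
have := trace_on_lin 1 preserves0 preserves0; rewrite mul1r.
under eq_fun do rewrite scaler0 addr0.
by move/eqP; rewrite -subr_eq0 opprD addNKr oppr_eq0 => /eqP.
Qed.

Lemma preserves_sum (J : Type) (r : seq J) (k : J -> C) (A : J -> U -> U) :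
  (forall j, preserves S (A j)) -> preserves S (fun x => \sum_(j <- r) k j *: A j x).
Proof.
move=> SA; elim: r => [|j r IHr].
  by under eq_fun do rewrite big_nil; exact: preserves0.
by under eq_fun do rewrite big_cons; exact: preserves_lin.
Qed.

Lemma trace_on_sum (J : Type) (r : seq J) (k : J -> C) (A : J -> U -> U) :
  (forall j, preserves S (A j)) ->
  trace_on S (fun x => \sum_(j <- r) k j *: A j x) = \sum_(j <- r) k j * trace_on S (A j).
Proof.
move=> SA; elim: r => [|j r IHr].
  by rewrite big_nil; under eq_fun do rewrite big_nil; exact: trace_on0.
rewrite big_cons -IHr; under eq_fun do rewrite big_cons.
by apply: trace_on_lin => //; exact: preserves_sum.
Qed.

End TraceOn.

(** Two subspaces are allowed because cyclicity is applied between [M(N)] and [M(N + t)]. *)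
Lemma trace_on_swap (U U' : lmodType C) (S : set U) (S' : set U')
    (A : U -> U') (B : U' -> U) :
  Defs.subspace S -> Defs.subspace S' -> finite_dim S -> finite_dim S' ->
  linear A -> linear B ->
  (forall x, S x -> S' (A x)) -> (forall y, S' y -> S (B y)) ->
  trace_on S (B \o A) = trace_on S' (A \o B).
Proof.
move=> subS subS' finS finS' linA linB AS BS.
apply: (is_trace_swap subS subS' linA linB AS BS); apply: trace_onP => //.
  by split=> [c x y|x Sx] /=; [rewrite linA linB | apply/BS/AS].
by split=> [c x y|x Sx] /=; [rewrite linB linA | apply/AS/BS].
Qed.

End Traces.

(** * Finite sums, linear maps and gradings *)

Section FiniteSums.

Lemma fsum_ord (V : zmodType) (F : nat -> V) n :
  (forall k, (n <= k)%N -> F k = 0) -> \sum_(k \in [set: nat]) F k = \sum_(k < n) F k.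
Proof.
move=> F0; rewrite (fsbig_ord _ n F); apply/esym/fsbig_widen => // k [_ /= lt_kn].
by apply: F0; rewrite leqNgt; apply/negP.
Qed.

Lemma fsum_ord1 (V : zmodType) (F : nat -> V) n :
  (forall k, (n <= k)%N -> F k.+1 = 0) ->
  \sum_(k \in [set k : nat | (1 <= k)%N]) F k = \sum_(k < n) F k.+1.
Proof.
move=> F0; rewrite fsbig_mkcond (@fsum_ord _ _ n.+1).
  rewrite big_ord_recl patchE memNset //= add0r; apply: eq_bigr => k _.
  by rewrite patchE mem_set.
move=> [//|k] le_nk; rewrite patchE; case: ifP => // _; exact: F0.
Qed.

Lemma sum_antidiagonal (V : nmodType) J (F : nat -> nat -> V) :
  (forall n j, (J <= n + j)%N -> F n j = 0) ->
  \sum_(i < J) \sum_(n < i.+1) F n (i - n)%N = \sum_(n < J) \sum_(j < J) F n j.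
Proof.
move=> F0; transitivity (\sum_(i < J) \sum_(n < J | (n <= i)%N) F n (i - n)%N).
  apply: eq_bigr => i _.
  by rewrite (big_ord_widen J (fun n => F n (i - n)%N)) //; apply: eq_bigl.
rewrite (exchange_big_dep xpredT) //=; apply: eq_bigr => n _.
have le_nJ : (n <= J)%N by exact: ltnW.
rewrite -(big_mkord (fun i => (n <= i)%N) (fun i => F n (i - n)%N)).
rewrite (@big_cat_nat _ _ _ n) //= big_nat_cond big1 ?add0r; last by move=> j; lia.
transitivity (\sum_(0 + n <= i < J | (n <= i)%N) F n (i - n)%N) => //.
rewrite big_addn -(big_mkord xpredT (F n)) [RHS](@big_cat_nat _ _ _ (J - n)) ?leq_subr //=.
rewrite [X in _ = _ + X]big_nat_cond [X in _ = _ + X]big1 ?addr0; last first.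
  by move=> j ltj; apply: F0; lia.
by apply: eq_big => j; rewrite ?leq_addl // addnK.
Qed.

(** In generating functions the hypothesis is [f = q^t (g + f)]; unrolling it expands
    [q^t / (1 - q^t)]. *)
Lemma sum_multiples (V : nmodType) (f g : nat -> V) t : (0 < t)%N ->
  (forall N, f N = if (t <= N)%N then g (N - t)%N + f (N - t)%N else 0) ->
  forall N, f N = \sum_(i < N.+1 | (0 < i)%N && (t %| i)%N) g (N - i)%N.
Proof.
move=> t0 fE N; elim/ltn_ind: N => N IHN; rewrite fE; case: leqP => [le_tN|lt_Nt].
  rewrite IHN; last by lia.
  have lt_tN : (t < N.+1)%N by [].
  rewrite [RHS](bigD1 (Ordinal lt_tN)) /= ?t0 ?dvdnn //; congr (_ + _).
  have le_N : (t <= N.+1)%N by lia.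
  rewrite -[LHS](big_mkord (fun i => (0 < i)%N && (t %| i)%N) (fun i => g (N - t - i)%N)).
  transitivity (\sum_(0 <= i < N.+1 | (0 < i)%N && (t %| i)%N && (i != t)) g (N - i)%N);
    last by rewrite big_mkord; apply: eq_bigl => i; rewrite -val_eqE.
  rewrite [RHS](@big_cat_nat _ _ _ t) //= [X in _ = X + _]big_nat_cond.
  rewrite [X in _ = X + _]big1 ?add0r; last first.
    by move=> i /andP[/andP[_ lt_it] /andP[/andP[i0 /dvdn_leq]]]; lia.
  transitivity (\sum_(0 + t <= i < N.+1 | (0 < i)%N && (t %| i)%N && (i != t)) g (N - i)%N) => //.
  rewrite big_addn (_ : N.+1 - t = (N - t).+1)%N; last by lia.
  apply: eq_big => i; last by move=> _; congr g; lia.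
  by rewrite dvdn_addl // andbAC; congr (_ && _); lia.
rewrite big1 // => i /andP[i0 /dvdn_leq]; have := ltn_ord i; lia.
Qed.

(** Collects Lambert series into divisor sums: as [i <= N], every divisor of [i] is some [t.+1] with
    [t < N]. *)
Lemma sum_divisors (V : nmodType) (f : nat -> V) N i : (0 < i <= N)%N ->
  \sum_(t < N | (t.+1 %| i)%N) f t.+1 = \sum_(d <- divisors i) f d.
Proof.
move=> /andP[i0 leiN].
transitivity (\sum_(t <- iota 1 N | (t %| i)%N) f t).
  rewrite -[iota 1 N]/(iota (1 + 0) N) iotaDl big_map.
  by rewrite -(big_mkord (fun t => (t.+1 %| i)%N) (fun t => f t.+1)) /index_iota subn0.
rewrite -big_filter; apply: perm_big; apply: uniq_perm.
- by rewrite filter_uniq ?iota_uniq.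
- exact: divisors_uniq.
move=> d; rewrite mem_filter mem_iota -dvdn_divisors //.
case: (boolP (d %| i)%N) => //= di; have := dvdn_leq i0 di.
have := dvdn_gt0 i0 di; lia.
Qed.

End FiniteSums.

Section LinearMaps.
Variables (C : fieldType) (U U' : lmodType C) (f : U -> U').
Hypothesis lin_f : linear f.

Let F : {linear U -> U'} := HB.pack f (GRing.isLinear.Build _ _ _ _ f lin_f).

Lemma lin0 : f 0 = 0. Proof. exact: (linear0 F). Qed.

Lemma linD x y : f (x + y) = f x + f y. Proof. exact: (linearD F). Qed.

Lemma linZ k x : f (k *: x) = k *: f x. Proof. by rewrite -[f]/(F : U -> U') linearZ. Qed.

Lemma lin_sum (J : Type) (r : seq J) (x : J -> U) :
  f (\sum_(j <- r) x j) = \sum_(j <- r) f (x j).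
Proof. exact: (linear_sum F). Qed.

End LinearMaps.

Section Gradings.
Variables (C : fieldType) (U : lmodType C) (G : grading U).

Lemma gproj_gcomp m n x : gcomp G n x -> gproj G m x = if m == n then x else 0.
Proof. by move=> xn; rewrite -{1}xn gproj_orth xn. Qed.

Lemma gcomp_gproj n x : gcomp G n (gproj G n x).
Proof. by rewrite /gcomp /= gproj_orth eqxx. Qed.

Lemma gcomp_subspace n : Defs.subspace (gcomp G n).
Proof.
split=> [|k x y]; rewrite /gcomp /= ?linear0 // => xn yn.
by rewrite linearP /= xn yn.
Qed.

Lemma gproj_bound x : exists N, forall n, (N <= n)%N -> gproj G n x = 0.
Proof.
have [N xE] := gproj_sum G x; exists N => n le_Nn.
rewrite xE linear_sum big1 // => i _; rewrite gproj_orth.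
by case: eqP => // ni; have := ltn_ord i; lia.
Qed.

Lemma gproj_decomp x N : (forall n, (N <= n)%N -> gproj G n x = 0) ->
  x = \sum_(n < N) gproj G n x.
Proof.
move=> x0; have [N' xE] := gproj_sum G x; rewrite {1}xE.
rewrite -(big_mkord xpredT (gproj G ^~ x)) -(big_mkord xpredT (gproj G ^~ x)).
case: (leqP N N') => [le|/ltnW le].
  rewrite (big_cat_nat _ le) //= [X in _ + X]big_nat_cond [X in _ + X]big1 ?addr0 //.
  by move=> i; rewrite andbT => /andP[/x0].
rewrite [RHS](big_cat_nat _ le) //= [X in _ = _ + X]big_nat_cond.
rewrite [X in _ = _ + X]big1 ?addr0 // => i; rewrite andbT => /andP[le_N'i _].
rewrite xE linear_sum big1 // => j _; rewrite gproj_orth.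
by case: eqP => // ij; have := ltn_ord j; lia.
Qed.

Lemma gcompz0 z : gcompz G z 0.
Proof. by case: z => n //=; exact: (gcomp_subspace n).1. Qed.

Lemma gcompz_neg z x : gcompz G z x -> z < 0 -> x = 0.
Proof. by case: z. Qed.

End Gradings.

(** * Modules and intertwining operators *)

Section BinomialValues.
Variable C : numFieldType.

Lemma binz_0 i : binz C 0 i = (i == 0)%N%:R.
Proof. by rewrite binzE mulr0z gbin_0 fps1. Qed.

Lemma binz_1 i : binz C 1 i = (i == 0)%N%:R + (i == 1)%N%:R.
Proof. by rewrite binzE gbin_1 fpsD fps1. Qed.

Lemma binz_N1 i : binz C (-1) i = (-1) ^+ i.
Proof.
rewrite binzE; elim: i => [|i IHi]; first by rewrite gbin0 expr0.
apply: (mulfI (natrS_neq0 C i)); rewrite gbinS IHi exprS -natr1 mulrNz mulr1z; ring.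
Qed.

Lemma binz_N2 i : binz C (- 2) i = (-1) ^+ i * i.+1%:R.
Proof.
have e : (- 2)%:~R = - (1 + 1) :> C by rewrite mulrNz -pmulrn.
rewrite binzE e; elim: i => [|i IHi]; first by rewrite gbin0 expr0 mulr1.
apply: (mulfI (natrS_neq0 C i)); rewrite gbinS IHi exprS -!natr1.
ring.
Qed.

End BinomialValues.

Section Modules.
Variables (R : realType) (V : voa R).
Local Notation C := R[i].

Lemma mode_lin1 (U M N : lmodType C) (Y : U -> int -> M -> N) n x :
  mode_linear Y -> linear (fun a => Y a n x).
Proof. by move=> linY; have [] := linY n. Qed.

Lemma mode_lin2 (U M N : lmodType C) (Y : U -> int -> M -> N) a n :
  mode_linear Y -> linear (Y a n).
Proof. by move=> linY; have [] := linY n. Qed.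

Lemma mode0l (U M N : lmodType C) (Y : U -> int -> M -> N) n x :
  mode_linear Y -> Y 0 n x = 0.
Proof. by move=> linY; rewrite (lin0 (mode_lin1 n x linY)). Qed.

Lemma mode0r (U M N : lmodType C) (Y : U -> int -> M -> N) a n :
  mode_linear Y -> Y a n 0 = 0.
Proof. by move=> linY; rewrite (lin0 (mode_lin2 a n linY)). Qed.

Lemma truncated_nat (U M N : lmodType C) (Y : U -> int -> M -> N) a x (m : int) :
  truncated Y -> exists J : nat, forall n : int, m + J%:Z <= n -> Y a n x = 0.
Proof.
move=> trY; have [n0 Y0] := trY a x; exists `|n0 - m|%N => n le_n.
by apply: Y0; lia.
Qed.

Lemma L0_gcomp (M : ordinary_module V) n x : gcomp (mod_gr M) n x ->
  mod_L 0 x = (conf_weight M + n%:R) *: x.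
Proof. by rewrite (conf_weightP M n). Qed.

Lemma gproj_L0 (M : ordinary_module V) n (x : M) :
  gproj (mod_gr M) n (mod_L 0 x) = (conf_weight M + n%:R) *: gproj (mod_gr M) n x.
Proof.
have [N x0] := gproj_bound (mod_gr M) x.
have linL : linear (mod_L 0 : M -> M) by apply: (mode_lin2 _ _ (@mod_linear _ _ M)).
rewrite {1}(gproj_decomp x0) (lin_sum linL) linear_sum.
transitivity (\sum_(k < N) if n == k then (conf_weight M + n%:R) *: gproj (mod_gr M) n x else 0).
  apply: eq_bigr => k _; rewrite (L0_gcomp (gcomp_gproj _ _ _)) linearZ /= gproj_orth.
  by case: eqP => [->|_] //; rewrite scaler0.
rewrite -big_mkcond /=; case: (ltnP n N) => [lt_nN|le_Nn].
  by rewrite (big_pred1 (Ordinal lt_nN)).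
rewrite x0 // scaler0 big_pred0 // => k.
by apply/negbTE/eqP => nk; have := ltn_ord k; lia.
Qed.

(** For negative [z] the conclusion is [x = 0]: the component of [x] in [M(k)] has eigenvalue
    [conf_weight M + k], which differs from [conf_weight M + z]. *)
Lemma L0_gcompz (M : ordinary_module V) (z : int) (x : M) :
  mod_L 0 x = (conf_weight M + z%:~R) *: x -> gcompz (mod_gr M) z x.
Proof.
case: z => n Lx; first by rewrite /= (conf_weightP M n).
rewrite /=; have [N x0] := gproj_bound (mod_gr M) x.
rewrite (gproj_decomp x0) big1 // => k _.
have /eqP := gproj_L0 k x.
rewrite Lx linearZ /= -subr_eq0 -scalerBl scaler_eq0 => /predU1P[e|/eqP //].
have : (Negz n - k%:Z)%:~R = 0 :> C.
  by rewrite -e intrB; ring.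
by move/eqP; rewrite intr_eq0 => /eqP; lia.
Qed.

(* The commutator with L(0) shows that the modes of I are homogeneous. *)
Lemma io_gcompz (W M : ordinary_module V) (I : intertwining_operator W M) d N n v x :
  gcomp (mod_gr W) d v -> gcomp (mod_gr M) N x ->
  gcompz (mod_gr M) (d%:Z - n - 1 + N%:Z) (io_mode I v n x).
Proof.
move=> vd xN; apply: L0_gcompz.
have linI := io_linear I.
(* The case [l = 0], [m = 1] is [[L(0), v_(n)] = (L(-1)v)_(n+1) + (L(0)v)_(n)]. *)
have /= := io_jacobi I (conformal V) v x 0 1 n.
rewrite (@fsum_ord _ _ 2); last first.
  by move=> [|[|k]] // _; rewrite binz_1 addr0 scale0r.
rewrite (@fsum_ord _ _ 1); last first.
  by move=> [|k] // _; rewrite binz_0 mulr0 scale0r.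
rewrite !big_ord_recr !big_ord0 /= !add0r !binz_1 binz_0 /= !addr0 add0r expr0.
rewrite !mulr1 !scale1r.
rewrite (L0_gcomp xN : mod_Y (conformal V) 1 x = _).
rewrite (L0_gcomp vd : mod_Y (conformal V) 1 v = _).
rewrite (io_Lm1 I v (1 + n) x : io_mode I (mod_Y (conformal V) 0 v) (1 + n) x = _).
rewrite (linZ (mode_lin1 _ _ linI)) (linZ (mode_lin2 _ _ linI)).
rewrite -[1 + n - 1%Z]addrAC subrr add0r -scalerDl.
set y := io_mode I v n x => e.
transitivity (mod_Y (conformal V) 1 y) => //.
rewrite -[LHS](subrK ((conf_weight M + N%:R) *: y)) -e -scalerDl; congr (_ *: _).
by rewrite !(intrD, intrB); ring.
Qed.

Lemma vir_Lm1_gcomp k (a : V) : gcomp (voa_gr V) k a ->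
  gcomp (voa_gr V) k.+1 (Lmode (conformal V) (@voa_Y _ V) (-1) a).
Proof.
move=> ak; rewrite voa_L0 /=.
have La : Lmode (conformal V) (@voa_Y _ V) 0 a = k%:R *: a by move: ak; rewrite voa_L0.
have := voa_virasoro 0 (-1) a.
have LZ c : Lmode (conformal V) (@voa_Y _ V) (-1) (c *: a) =
    c *: Lmode (conformal V) (@voa_Y _ V) (-1) a.
  exact: (linZ (mode_lin2 _ _ (voa_linear V))).
rewrite /= La LZ scale0r addr0 add0r sub0r opprK scale1r.
by move/eqP; rewrite subr_eq => /eqP ->; rewrite -natr1 addrC scalerDl scale1r.
Qed.

Lemma vir_Lm1_vacuum (a : V) :
  Lmode (conformal V) (@voa_Y _ V) (-1) a = voa_Y a (-2) (vacuum V).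
Proof.
have [<- _] := voa_creation (Lmode (conformal V) (@voa_Y _ V) (-1) a).
by rewrite voa_Lm1 opprK scale1r.
Qed.

(** Not an axiom of [weak_module]: since [L(-1)a] is [a_(-2)] applied to the vacuum, it follows from
    the Jacobi identity for [a] and the vacuum at [l = -2], [m = 0]. *)
Lemma mod_Lm1 (M : weak_module V) (a : V) n (x : M) :
  mod_Y (Lmode (conformal V) (@voa_Y _ V) (-1) a) n x = (- n)%:~R *: mod_Y a (n - 1) x.
Proof.
have linM := @mod_linear _ _ M.
have := mod_jacobi a (vacuum V) x (- 2) 0 n.
rewrite (@fsum_ord _ _ 1); last by move=> [|k] // _; rewrite binz_0 scale0r.
rewrite big_ord1 binz_0 scale1r subr0 add0r addr0 -vir_Lm1_vacuum => ->.
have coef i : (-1) ^+ i * binz C (- 2) i = i.+1%:R by rewrite binz_N2 signrMK.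
rewrite (@fsum_ord _ _ `|n|%N); last first.
  move=> i le_ni; rewrite !mod_vacuum.
  case: eqP => e1; first by lia.
  case: eqP => e2; first by lia.
  by rewrite (mode0r _ _ linM) scaler0 subr0 scaler0.
(* A vacuum mode survives only at index [-1]: for [n < 0] in the first product at [i = - n - 1], for
   [n > 0] in the second at [i = n - 1], for [n = 0] nowhere. *)
have zero (i : nat) (y : M) : n + i%:Z != -1 -> n + (- 2) - i%:Z != -1 ->
    ((-1) ^+ i * binz C (- 2) i) *: (mod_Y a (0 + (- 2) - i%:Z)
      (mod_Y (vacuum V) (n + i%:Z) x) -
      (-1) ^ (- 2) *: mod_Y (vacuum V) (n + (- 2) - i%:Z) (mod_Y a (0 + i%:Z) x)) = 0.
  move=> /negbTE e1 /negbTE e2; rewrite !mod_vacuum e1 e2.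
  by rewrite (mode0r _ _ linM) scaler0 subr0 scaler0.
case: n zero => [[|p]|p] zero.
- by rewrite big_ord0 oppr0 mulr0z scale0r.
- rewrite big_ord_recr big1 ?add0r /=; last first.
    by move=> i _; apply: zero => //; have := ltn_ord i; lia.
  rewrite coef !mod_vacuum; case: eqP => e1; first by lia.
  case: eqP => e2; last by lia.
  rewrite (mode0r _ _ linM) sub0r add0r (_ : p.+1%:Z - 1 = p%:Z); last by lia.
  rewrite -exprnN expr2 mulrNN mulr1 invr1 scale1r scalerN mulrNz scaleNr.
  by rewrite -pmulrn.
- rewrite big_ord_recr big1 ?add0r /=; last first.
    by move=> i _; apply: zero => //; have := ltn_ord i; lia.
  rewrite coef !mod_vacuum; case: eqP => e1; last by lia.
  case: eqP => e2; first by lia.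
  rewrite scaler0 subr0 NegzE opprK (_ : 0 - 2 - p%:Z = - p.+1%:Z - 1); last by lia.
  by rewrite add0r -pmulrn.
Qed.


Section ZeroModes.
Variables (W M : ordinary_module V) (I : intertwining_operator W M).

Lemma io_zero_modeE w x K : (forall n, (K <= n)%N -> gproj (mod_gr W) n w = 0) ->
  io_zero_mode I w x = \sum_(n < K) io_mode I (gproj (mod_gr W) n w) (n%:Z - 1) x.
Proof.
by move=> w0; apply: fsum_ord => n /w0 ->; rewrite (mode0l _ _ (io_linear I)).
Qed.

Lemma io_zero_mode_linl x : linear (fun w => io_zero_mode I w x).
Proof.
move=> k w w' /=.
have [K1 H1] := gproj_bound (mod_gr W) w; have [K2 H2] := gproj_bound (mod_gr W) w'.
rewrite !(@io_zero_modeE _ _ (maxn K1 K2)).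
- rewrite scaler_sumr -big_split; apply: eq_bigr => n _ /=.
  by rewrite linearP (mode_lin1 _ _ (io_linear I)).
- by move=> n; rewrite geq_max => /andP[_ /H2].
- by move=> n; rewrite geq_max => /andP[/H1].
- by move=> n; rewrite geq_max => /andP[le1 le2]; rewrite linearP /= H1 // H2 // scaler0 addr0.
Qed.

Lemma io_zero_mode_preserves w N : preserves (gcomp (mod_gr M) N) (io_zero_mode I w).
Proof.
have [K w0] := gproj_bound (mod_gr W) w; split=> [k x y|x xN].
  rewrite !(io_zero_modeE _ w0) scaler_sumr -big_split; apply: eq_bigr => n _ /=.
  by rewrite (mode_lin2 _ _ (io_linear I)).
rewrite (io_zero_modeE _ w0).
have [S0 SD] := gcomp_subspace (mod_gr M) N.
apply: (big_ind (gcomp (mod_gr M) N)) => // [y z Sy Sz|n _].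
  by rewrite -[y]scale1r; exact: SD.
have := io_gcompz I (n%:Z - 1) (gcomp_gproj (mod_gr W) n w) xN.
by rewrite (_ : n%:Z - (n%:Z - 1) - 1 + N%:Z = N%:Z) //; lia.
Qed.

Lemma io_zero_mode_gcompz z w x : gcompz (mod_gr W) z w ->
  io_zero_mode I w x = io_mode I w (z - 1) x.
Proof.
case: z => n wz; last first.
  by rewrite wz (lin0 (io_zero_mode_linl x)) (mode0l _ _ (io_linear I)).
rewrite (@io_zero_modeE _ _ n.+1).
  rewrite big_ord_recr /= big1 ?add0r ?(gproj_gcomp _ wz) ?eqxx // => i _.
  rewrite (gproj_gcomp _ wz) ltn_eqF ?ltn_ord //.
  by rewrite (mode0l _ _ (io_linear I)).
by move=> j lt_nj; rewrite (gproj_gcomp _ wz) gtn_eqF.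
Qed.

Lemma zero_modeE a x K : (forall n, (K <= n)%N -> gproj (voa_gr V) n a = 0) ->
  zero_mode (M := M) a x = \sum_(n < K) mod_Y (gproj (voa_gr V) n a) (n%:Z - 1) x.
Proof.
by move=> a0; apply: fsum_ord => n /a0 ->; rewrite (mode0l _ _ (@mod_linear _ _ M)).
Qed.

Lemma zero_mode_linl (x : M) : linear (fun a => zero_mode (M := M) a x).
Proof.
move=> k a a' /=.
have [K1 H1] := gproj_bound (voa_gr V) a; have [K2 H2] := gproj_bound (voa_gr V) a'.
rewrite !(@zero_modeE _ _ (maxn K1 K2)).
- rewrite scaler_sumr -big_split; apply: eq_bigr => n _ /=.
  by rewrite linearP (mode_lin1 _ _ (@mod_linear _ _ M)).
- by move=> n; rewrite geq_max => /andP[_ /H2].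
- by move=> n; rewrite geq_max => /andP[/H1].
- by move=> n; rewrite geq_max => /andP[le1 le2]; rewrite linearP /= H1 // H2 // scaler0 addr0.
Qed.

Lemma zero_mode_preserves a N : preserves (gcomp (mod_gr M) N) (zero_mode (M := M) a).
Proof.
have [K a0] := gproj_bound (voa_gr V) a; split=> [k x y|x xN].
  rewrite !(zero_modeE _ a0) scaler_sumr -big_split; apply: eq_bigr => n _ /=.
  by rewrite (mode_lin2 _ _ (@mod_linear _ _ M)).
rewrite (zero_modeE _ a0).
have [S0 SD] := gcomp_subspace (mod_gr M) N.
apply: (big_ind (gcomp (mod_gr M) N)) => // [y z Sy Sz|n _].
  by rewrite -[y]scale1r; exact: SD.
have := mod_graded (n%:Z - 1) (gcomp_gproj (voa_gr V) n a) xN.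
by rewrite (_ : n%:Z - (n%:Z - 1) - 1 + N%:Z = N%:Z) //; lia.
Qed.

Lemma zero_mode_gcomp k a (x : M) : gcomp (voa_gr V) k a ->
  zero_mode (M := M) a x = mod_Y a (k%:Z - 1) x.
Proof.
move=> ak; rewrite (@zero_modeE _ _ k.+1).
  rewrite big_ord_recr /= big1 ?add0r ?(gproj_gcomp _ ak) ?eqxx // => i _.
  rewrite (gproj_gcomp _ ak) ltn_eqF ?ltn_ord //.
  by rewrite (mode0l _ _ (@mod_linear _ _ M)).
by move=> j lt_kj; rewrite (gproj_gcomp _ ak) gtn_eqF.
Qed.

End ZeroModes.

(** * The modes [a[m]] and the derivation [L[-1]] *)

Section SquareModes.
Variable W : ordinary_module V.
Local Notation linW := (@mod_linear _ _ W).

(** One bound serves both sums, because only finitely many components of [a] are nonzero. Modes of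
    different vectors can then be compared over common finite ranges. *)
Lemma sq_mode_bound (m : int) a (v : W) : exists B : nat, forall K J : nat,
  (B <= K)%N -> (B <= J)%N ->
  sq_mode a m v = \sum_(k < K) two_pi_i R ^ (- m - 1) *:
    \sum_(j < J) ln_coef C m (k%:Z - 1) j *: mod_Y (gproj (voa_gr V) k a) (m + j%:Z) v.
Proof.
have [K0 a0] := gproj_bound (voa_gr V) a.
have /choice[n0 Y0] : forall k, exists J : nat, forall n : int, m + J%:Z <= n ->
    mod_Y (gproj (voa_gr V) k a) n v = 0.
  by move=> k; exact: truncated_nat (@mod_truncated _ _ W).
exists (maxn K0 (\max_(k < K0) n0 k)) => K J; rewrite !geq_max => /andP[leK _] /andP[_ leJ].
have H k : \sum_(j \in [set: nat]) ln_coef C m (k%:Z - 1) j *: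
      mod_Y (gproj (voa_gr V) k a) (m + j%:Z) v =
    \sum_(j < J) ln_coef C m (k%:Z - 1) j *: mod_Y (gproj (voa_gr V) k a) (m + j%:Z) v.
  apply: fsum_ord => j leJj; case: (ltnP k K0) => [ltk|/a0 ->].
    rewrite Y0 ?scaler0 // lerD2l lez_nat (leq_trans _ leJj) // (leq_trans _ leJ) //.
    exact: (leq_bigmax (Ordinal ltk)).
  by rewrite (mode0l _ _ linW) scaler0.
rewrite /sq_mode (@fsum_ord _ _ K); first by apply: eq_bigr => k _; rewrite H.
move=> k leKk; rewrite H big1 ?scaler0 // => j _.
by rewrite a0 ?(leq_trans leK) // (mode0l _ _ linW) scaler0.
Qed.

Lemma sq_mode_linl m v : linear (fun a => sq_mode (W := W) a m v).
Proof.
move=> c a a' /=; have [B1 H1] := sq_mode_bound m a v.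
have [B2 H2] := sq_mode_bound m a' v; have [B3 H3] := sq_mode_bound m (c *: a + a') v.
pose B := maxn B1 (maxn B2 B3).
have [leB1 leB2 leB3] : [/\ B1 <= B, B2 <= B & B3 <= B]%N by split; rewrite /B; lia.
rewrite (H1 B B) // (H2 B B) // (H3 B B) // scaler_sumr -big_split.
apply: eq_bigr => k _ /=; rewrite scalerA mulrC -scalerA -scalerDr; congr (_ *: _).
rewrite scaler_sumr -big_split; apply: eq_bigr => j _ /=.
by rewrite linearP (mode_lin1 _ _ linW) scalerDr !scalerA mulrC.
Qed.

Lemma sq_mode_linr a m : linear (sq_mode (W := W) a m).
Proof.
move=> c v v' /=; have [B1 H1] := sq_mode_bound m a v.
have [B2 H2] := sq_mode_bound m a v'; have [B3 H3] := sq_mode_bound m a (c *: v + v').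
pose B := maxn B1 (maxn B2 B3).
have [leB1 leB2 leB3] : [/\ B1 <= B, B2 <= B & B3 <= B]%N by split; rewrite /B; lia.
rewrite (H1 B B) // (H2 B B) // (H3 B B) // scaler_sumr -big_split.
apply: eq_bigr => k _ /=; rewrite scalerA mulrC -scalerA -scalerDr; congr (_ *: _).
rewrite scaler_sumr -big_split; apply: eq_bigr => j _ /=.
by rewrite (mode_lin2 _ _ linW) scalerDr !scalerA mulrC.
Qed.

Lemma sq_mode_gcomp k a m (v : W) J : gcomp (voa_gr V) k a ->
  (forall j, (J <= j)%N -> mod_Y a (m + j%:Z) v = 0) ->
  sq_mode a m v = two_pi_i R ^ (- m - 1) *:
    \sum_(j < J) ln_coef C m (k%:Z - 1) j *: mod_Y a (m + j%:Z) v.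
Proof.
move=> ak Y0; rewrite /sq_mode (@fsum_ord _ _ k.+1); last first.
  move=> i lt_ki; rewrite (gproj_gcomp _ ak) gtn_eqF // (@fsum_ord _ _ 0) ?big_ord0 ?scaler0 //.
  by move=> j _; rewrite (mode0l _ _ linW) scaler0.
rewrite big_ord_recr /= big1 ?add0r; last first.
  move=> i _; rewrite (gproj_gcomp _ ak) ltn_eqF ?ltn_ord //.
  rewrite (@fsum_ord _ _ 0) ?big_ord0 ?scaler0 // => j _.
  by rewrite (mode0l _ _ linW) scaler0.
rewrite (gproj_gcomp _ ak) eqxx; congr (_ *: _).
by apply: fsum_ord => j /Y0 ->; rewrite scaler0.
Qed.

Lemma sq_mode_truncated a (v : W) : exists n0 : nat, forall n : int, n0%:Z <= n ->
  sq_mode a n v = 0.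
Proof.
have [K a0] := gproj_bound (voa_gr V) a.
have /choice[n0 Y0] : forall k, exists J : nat, forall n : int, 0 + J%:Z <= n ->
    mod_Y (gproj (voa_gr V) k a) n v = 0.
  by move=> k; exact: truncated_nat (@mod_truncated _ _ W).
exists (\max_(k < K) n0 k) => n le_n.
rewrite (gproj_decomp a0) (lin_sum (sq_mode_linl n v)) big1 // => k _.
rewrite (sq_mode_gcomp (J := 0) (gcomp_gproj _ _ _)) ?big_ord0 ?scaler0 // => j _.
have : (n0 k <= \max_(k < K) n0 k)%N by exact: (leq_bigmax k).
by move: (\max_(k < K) n0 k) le_n => B le_n le_B; apply: Y0; lia.
Qed.

(* [L[-1] / (2 pi i)] *)
Definition sq_derivation (a : V) : V :=
  Lmode (conformal V) (@voa_Y _ V) (-1) a + Lmode (conformal V) (@voa_Y _ V) 0 a.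

Lemma sq_derivation_lin : linear sq_derivation.
Proof.
move=> c a b; rewrite /sq_derivation /Lmode !(mode_lin2 _ _ (voa_linear V)).
by rewrite scalerDr addrACA.
Qed.

Lemma sq_derivation_gcomp k a : gcomp (voa_gr V) k a ->
  sq_derivation a = Lmode (conformal V) (@voa_Y _ V) (-1) a + k%:R *: a.
Proof. by move=> ak; congr (_ + _); move: ak; rewrite voa_L0. Qed.

(** Integration by parts under the residue: for [b] of weight [k], [L(-1)b] differentiates the
    kernel [(ln(1+z))^n (1+z)^k], and [L(0)b = k b] cancels the term coming from [(1+z)^k]. *)
Lemma sq_derivation_mode a n (v : W) :
  two_pi_i R *: sq_mode (sq_derivation a) n v = (- n)%:~R *: sq_mode a (n - 1) v.
Proof.
have [K a0] := gproj_bound (voa_gr V) a.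
rewrite (gproj_decomp a0) (lin_sum sq_derivation_lin) !(lin_sum (sq_mode_linl _ v)).
rewrite !scaler_sumr; apply: eq_bigr => k _.
move: (gcomp_gproj (voa_gr V) k a); set b := gproj _ _ _ => bk.
rewrite (sq_derivation_gcomp bk) addrC (sq_mode_linl n v).
have [J Y0] : exists J : nat, forall m : int, n - 1 + J%:Z <= m -> mod_Y b m v = 0.
  exact: truncated_nat (@mod_truncated _ _ W).
have nz : two_pi_i R != 0 := two_pi_i_neq0 R.
rewrite (sq_mode_gcomp (J := J) bk); last by move=> j leJj; apply: Y0; lia.
rewrite (sq_mode_gcomp (J := J) bk); last by move=> j leJj; apply: Y0; lia.
rewrite (sq_mode_gcomp (J := J.+1) (vir_Lm1_gcomp bk)); last first.
  by move=> j leJj; rewrite mod_Lm1 Y0 ?scaler0 //; lia.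
have -> : two_pi_i R ^ (- (n - 1) - 1) = two_pi_i R * two_pi_i R ^ (- n - 1).
  by rewrite (_ : - (n - 1) - 1 = 1 + (- n - 1)) ?expfzDr ?expr1z //; lia.
rewrite [k%:R *: _]scalerA [k%:R * _]mulrC -scalerA -scalerDr !scalerA.
rewrite [(- n)%:~R * _]mulrC -[RHS]scalerA; congr (_ *: _).
rewrite (_ : k.+1%:Z - 1 = k%:Z); last by lia.
have -> : \sum_(j < J) ln_coef C n (k%:Z - 1) j *: mod_Y b (n + j%:Z) v =
    \sum_(j < J.+1) (if (j : nat) is i.+1 then ln_coef C n (k%:Z - 1) i else 0) *:
      mod_Y b (n - 1 + j%:Z) v.
  rewrite big_ord_recl scale0r add0r; apply: eq_bigr => j _ /=.
  by congr (_ *: mod_Y b _ v); rewrite /bump /=; lia.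
have -> : \sum_(j < J) ln_coef C (n - 1) (k%:Z - 1) j *: mod_Y b (n - 1 + j%:Z) v =
    \sum_(j < J.+1) ln_coef C (n - 1) (k%:Z - 1) j *: mod_Y b (n - 1 + j%:Z) v.
  by rewrite big_ord_recr /= Y0 // scaler0 addr0.
rewrite !scaler_sumr -big_split; apply: eq_bigr => j _ /=.
rewrite mod_Lm1 !scalerA (_ : n + j%:Z - 1 = n - 1 + j%:Z); last by lia.
rewrite -scalerDl; congr (_ *: _).
have := ln_coef_rec C n k%:Z j; rewrite !mulrNz -pmulrn => e.
by rewrite mulrN [_ * (n + _)%:~R]mulrC e opprD mulNr addrCA subrr addr0.
Qed.

(** For [b] of weight [k], [(L(-1)b)_(k) = - k b_(k-1)] cancels the zero mode of [k b]. *)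
Lemma zero_mode_sq_derivation a (x : W) : zero_mode (M := W) (sq_derivation a) x = 0.
Proof.
have [K a0] := gproj_bound (voa_gr V) a.
rewrite (gproj_decomp a0) (lin_sum sq_derivation_lin) (lin_sum (zero_mode_linl x)).
rewrite big1 // => k _.
move: (gcomp_gproj (voa_gr V) k a); set b := gproj _ _ _ => bk.
rewrite (sq_derivation_gcomp bk) addrC (zero_mode_linl x) /=.
rewrite (zero_mode_gcomp _ bk) (zero_mode_gcomp _ (vir_Lm1_gcomp bk)) mod_Lm1.
rewrite (_ : k.+1%:Z - 1 = k%:Z); last by lia.
by rewrite -scalerDl mulrNz -pmulrn subrr scale0r.
Qed.

End SquareModes.

End Modules.

(** * Trace functions *)

Section TraceFunctions.
Variables (R : realType) (V : voa R) (W M : ordinary_module V).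
Variable I : intertwining_operator W M.
Local Notation C := R[i].
Local Notation MN := (gcomp (mod_gr M)).

Let subM N : Defs.subspace (MN N). Proof. exact: gcomp_subspace. Qed.
Let finM N : finite_dim (MN N). Proof. exact: omod_fin_dim. Qed.

(** The coefficient [N] belongs to the exponent [N + h_M - c/24]; without the common shift,
    Eisenstein series multiply in the ring [fps C]. *)
Definition io_trace (w : W) : fps C := fun N => trace_on (MN N) (io_zero_mode I w).

Lemma io_trace_sum (J : Type) (r : seq J) (k : J -> C) (w : J -> W) N :
  io_trace (\sum_(j <- r) k j *: w j) N = \sum_(j <- r) k j * io_trace (w j) N.
Proof.
rewrite -(trace_on_sum (subM N) (finM N)); last by move=> j; exact: io_zero_mode_preserves.
apply: trace_on_ext => x _.
rewrite (lin_sum (io_zero_mode_linl I x)); apply: eq_bigr => j _.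
exact: (linZ (io_zero_mode_linl I x)).
Qed.

Lemma io_trace_lin c w w' N : io_trace (c *: w + w') N = c * io_trace w N + io_trace w' N.
Proof.
have := io_trace_sum [:: (c, w); (1, w')] fst snd N.
by rewrite !big_cons !big_nil !addr0 /= scale1r mul1r.
Qed.

Lemma io_traceZ c w N : io_trace (c *: w) N = c * io_trace w N.
Proof. by have := io_trace_sum [:: w] (fun=> c) id N; rewrite !big_seq1. Qed.

Lemma io_trace0 N : io_trace 0 N = 0.
Proof. by rewrite -(scale0r 0) io_traceZ mul0r. Qed.

(** * The identities for homogeneous [a] and [v] *)

Section Homogeneous.
Variables (k d : nat) (a : V) (v : W).
Hypotheses (ak : gcomp (voa_gr V) k a) (vd : gcomp (mod_gr W) d v).

Let linM := @mod_linear _ _ M.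
Let linI := io_linear I.

Let A (s : int) (x : M) : M := mod_Y a (k%:Z - 1 + s) x.
Let B (s : int) (x : M) : M := io_mode I v (d%:Z - 1 - s) x.

Let linA s : linear (A s). Proof. exact: mode_lin2. Qed.
Let linB s : linear (B s). Proof. exact: mode_lin2. Qed.

Let A_gcompz z s x : gcompz (mod_gr M) z x -> gcompz (mod_gr M) (z - s) (A s x).
Proof.
case: z => n xz; last by rewrite xz (lin0 (linA s)); exact: gcompz0.
have := mod_graded (k%:Z - 1 + s) ak xz.
by rewrite (_ : k%:Z - (k%:Z - 1 + s) - 1 + n%:Z = n%:Z - s) //; lia.
Qed.

Let B_gcompz z s x : gcompz (mod_gr M) z x -> gcompz (mod_gr M) (z + s) (B s x).
Proof.
case: z => n xz; last by rewrite xz (lin0 (linB s)); exact: gcompz0.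
have := io_gcompz I (d%:Z - 1 - s) vd xz.
by rewrite (_ : d%:Z - (d%:Z - 1 - s) - 1 + n%:Z = n%:Z + s) //; lia.
Qed.

Let alpha s N : C := trace_on (MN N) (A s \o B s).
Let beta s N : C := trace_on (MN N) (B s \o A s).

Let AB_preserves s N : preserves (MN N) (A s \o B s).
Proof.
split=> [c x y|x xN] /=; first by rewrite linB linA.
by have := A_gcompz s (@B_gcompz N%:Z s x xN); rewrite addrK.
Qed.

Let BA_preserves s N : preserves (MN N) (B s \o A s).
Proof.
split=> [c x y|x xN] /=; first by rewrite linA linB.
by have := B_gcompz s (@A_gcompz N%:Z s x xN); rewrite subrK.
Qed.

Let alpha_shift (t N : nat) : alpha t N = beta t (N + t)%N.
Proof.
apply: trace_on_swap => // [x xN|y yN].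
  exact: (@B_gcompz N%:Z t x xN).
by have := @A_gcompz (N + t)%N%:Z t y yN; rewrite PoszD addrK.
Qed.

Let beta_shift (t N : nat) : beta (- t%:Z) N = alpha (- t%:Z) (N + t)%N.
Proof.
apply: trace_on_swap => // [x xN|y yN].
  by have := @A_gcompz N%:Z (- t%:Z) x xN; rewrite opprK -PoszD.
by have := @B_gcompz (N + t)%N%:Z (- t%:Z) y yN; rewrite PoszD addrK.
Qed.

Let beta0 (t N : nat) : (N < t)%N -> beta t N = 0.
Proof.
move=> ltNt; apply: (trace_on0 (subM N) (finM N)) => x xN /=.
rewrite (gcompz_neg (@A_gcompz N%:Z t x xN)) ?(lin0 (linB t)) //; lia.
Qed.

Let alpha0 (t N : nat) : (N < t)%N -> alpha (- t%:Z) N = 0.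
Proof.
move=> ltNt; apply: (trace_on0 (subM N) (finM N)) => x xN /=.
rewrite (gcompz_neg (@B_gcompz N%:Z (- t%:Z) x xN)) ?(lin0 (linA _)) //; lia.
Qed.

Let mode_zero (i : int) (x : M) :
  io_zero_mode I (mod_Y a i v) x = io_mode I (mod_Y a i v) (k%:Z + d%:Z - 2 - i) x.
Proof.
rewrite (io_zero_mode_gcompz I x (mod_graded i ak vd)); congr io_mode; lia.
Qed.

Variable J0 : nat.
Hypothesis v0 : forall n : int, J0%:Z <= n -> mod_Y a n v = 0.

Let T (j : int) : fps C := io_trace (mod_Y a j v).

Let T0 (j : int) N : J0%:Z <= j -> T j N = 0.
Proof. by move=> /v0 e; rewrite /T e io_trace0. Qed.

(** Sums over the modes [a_(i-1)] start at index [-1] and so need one term more than [J0]. *)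
Let J := J0.+1.

Let commutator s x : A s (B s x) - B s (A s x) =
  \sum_(i < J) binz C (k%:Z - 1 + s) i *: io_zero_mode I (mod_Y a i%:Z v) x.
Proof.
have := io_jacobi I a v x 0 (k%:Z - 1 + s) (d%:Z - 1 - s).
rewrite (@fsum_ord _ _ J); last first.
  by move=> i leJi; rewrite v0 ?(mode0l _ _ linI) ?scaler0 // /J; lia.
rewrite (@fsum_ord _ _ 1); last by move=> [|i] // _; rewrite binz_0 mulr0 scale0r.
rewrite big_ord1 binz_0 expr0 mulr1 !scale1r !addr0 ?subr0.
rewrite /A /B => <-; apply: eq_bigr => i _; rewrite mode_zero add0r.
by congr (_ *: io_mode I _ _ x); lia.
Qed.

(** The Jacobi identity at [l = -1]: here [(-1)^i * binz (-1) i = 1], and the sign [(-1)^l] makes a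
    sum of the difference. On [M(N)] it stops at [i = N], since beyond that [A i] and [B (- i.+1)]
    lead below degree [0]. *)
Let associator N x : MN N x ->
  \sum_(i < J) binz C (k%:Z - 1) i *: io_zero_mode I (mod_Y a (i%:Z - 1) v) x =
  \sum_(i < N.+1) (A (- i.+1%:Z) (B (- i.+1%:Z) x) + B i%:Z (A i%:Z x)).
Proof.
move=> xN; have := io_jacobi I a v x (-1) (k%:Z - 1) d%:Z.
rewrite (@fsum_ord _ _ J); last first.
  move=> i leJi; rewrite v0 ?(mode0l _ _ linI) ?scaler0 //; move: leJi; rewrite /J; lia.
rewrite (@fsum_ord _ _ N.+1); last first.
  move=> i leNi; have := gcompz_neg (@B_gcompz N%:Z (- i.+1%:Z) x xN).
  have := gcompz_neg (@A_gcompz N%:Z i%:Z x xN).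
  rewrite /A /B => -> ; last by lia.
  rewrite (_ : d%:Z - 1 - - i.+1%:Z = d%:Z + i%:Z); last by lia.
  by move=> ->; [rewrite (mode0r _ _ linM) (mode0r _ _ linI) scaler0 subr0 scaler0 | lia].
move=> e; transitivity (\sum_(i < J) binz C (k%:Z - 1) i *:
    io_mode I (mod_Y a (-1 + i%:Z) v) (k%:Z - 1 + d%:Z - i%:Z) x).
  apply: eq_bigr => i _; rewrite mode_zero [-1 + _]addrC.
  by congr (_ *: io_mode I _ _ x); lia.
rewrite e; apply: eq_bigr => i _; rewrite binz_N1 -expr2 sqrr_sign scale1r.
rewrite (_ : (-1 : C) ^ (-1) = -1); last by rewrite -exprnN expr1 invrN1.
rewrite scaleN1r opprK /A /B.
by congr (mod_Y a _ (io_mode I v _ x) + io_mode I v _ _); lia.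
Qed.

Let c (s : int) : fps C := fun N => \sum_(i < J) binz C (k%:Z - 1 + s) i * T i%:Z N.

Let alpha_beta s N : alpha s N - beta s N = c s N.
Proof.
have := trace_on_lin (subM N) (finM N) (-1) (BA_preserves s N) (AB_preserves s N).
rewrite mulN1r addrC => <-.
rewrite /c -(trace_on_sum (subM N) (finM N)); last by move=> i; exact: io_zero_mode_preserves.
by apply: trace_on_ext => x _; rewrite scaleN1r addrC commutator.
Qed.

(** Cyclicity gives [beta t N = alpha t (N - t)], and [alpha t = beta t + c t]: in coefficients,
    [(1 - q^t) beta = q^t c]. *)
Let beta_multiples t N : (0 < t)%N ->
  beta t N = \sum_(i < N.+1 | (0 < i)%N && (t %| i)%N) c t (N - i)%N.
Proof.
move=> t0; apply: (@sum_multiples _ (beta t) (c t)) => // {}N; case: leqP => [letN|/beta0 //].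
by rewrite -alpha_beta subrK alpha_shift subnK.
Qed.

Let alpha_multiples t N : (0 < t)%N ->
  alpha (- t%:Z) N = \sum_(i < N.+1 | (0 < i)%N && (t %| i)%N) - c (- t%:Z) (N - i)%N.
Proof.
move=> t0; apply: (@sum_multiples _ (alpha (- t%:Z)) (fun n => - c (- t%:Z) n)) => // {}N.
case: leqP => [letN|/alpha0 //].
by rewrite -alpha_beta opprB subrK beta_shift subnK.
Qed.

Let c0 N : c 0 N = 0.
Proof. by rewrite -alpha_beta (alpha_shift 0) addn0 subrr. Qed.

Let associator_trace N :
  \sum_(i < J) binz C (k%:Z - 1) i * T (i%:Z - 1) N =
  alpha 0 N + \sum_(t < N) \sum_(i < N.+1 | (0 < i)%N && (t.+1 %| i)%N)
    (c t.+1%:Z (N - i)%N - c (- t.+1%:Z) (N - i)%N).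
Proof.
rewrite -(trace_on_sum (subM N) (finM N)); last by move=> i; exact: io_zero_mode_preserves.
pose Op i x := 1 *: A (- i.+1%:Z) (B (- i.+1%:Z) x) + B i%:Z (A i%:Z x).
transitivity (trace_on (MN N) (fun x => \sum_(i <- enum 'I_N.+1) 1 *: Op i x)).
  apply: trace_on_ext => x xN; rewrite (associator xN) big_enum.
  by apply: eq_bigr => i _; rewrite /Op !scale1r.
rewrite (trace_on_sum (subM N) (finM N)); last first.
  by move=> i; exact: (preserves_lin (subM N) _ (AB_preserves _ N) (BA_preserves _ N)).
rewrite big_enum /=.
transitivity (\sum_(i < N.+1) (alpha (- i.+1%:Z) N + beta i%:Z N)).
  apply: eq_bigr => i _.
  rewrite mul1r (trace_on_lin (subM N) (finM N) 1 (AB_preserves _ N) (BA_preserves _ N)).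
  by rewrite mul1r.
(* The last [alpha] term vanishes by degree and the first [beta] term is [beta 0 = alpha 0]; the
   rest pairs [alpha (- t)] with [beta t] for [t] from [1] to [N]. *)
rewrite big_split big_ord_recr big_ord_recl /= alpha0 // addr0 addrCA.
congr (_ + _); first by rewrite -[RHS](subrK (beta 0 N)) alpha_beta c0 add0r.
rewrite -big_split; apply: eq_bigr => t _ /=.
rewrite alpha_multiples // beta_multiples // -big_split; apply: eq_bigr => i _ /=.
by rewrite addrC.
Qed.

(** Trace of the residue that defines [a[n]v], before its normalization by a power of [2 pi i]. *)
Let D (n : int) : fps C := fun N => \sum_(j < J) ln_coef C n (k%:Z - 1) j * T (n + j%:Z) N.

(** The bound [-1 <= n] ensures that the [J] terms of [D] exhaust the residue. *)
Let D_sq n N : -1 <= n -> D n N = two_pi_i R ^ (n + 1) * io_trace (sq_mode a n v) N.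
Proof.
move=> len; rewrite (@sq_mode_gcomp _ _ _ k _ _ _ J ak); last first.
  by move=> j leJj; apply: v0; move: leJj; rewrite /J; lia.
rewrite io_traceZ mulrA -expfzDr ?two_pi_i_neq0 //.
rewrite (_ : n + 1 + (- n - 1) = 0); last by lia.
by rewrite expr0z mul1r io_trace_sum.
Qed.

Let D0 (n N : nat) : (J0 <= n)%N -> D n N = 0.
Proof. by move=> len; rewrite /D big1 // => j _; rewrite T0 ?mulr0 //; lia. Qed.

Let cE s N : c s N = \sum_(n < J) s%:~R ^+ n / n`!%:R * D n N.
Proof.
pose F n j := s%:~R ^+ n / n`!%:R * (ln_coef C n%:Z (k%:Z - 1) j * T (n%:Z + j%:Z) N).
transitivity (\sum_(i < J) \sum_(n < i.+1) F n (i - n)%N).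
  apply: eq_bigr => i _; rewrite binz_ln_coef mulr_suml; apply: eq_bigr => n _.
  rewrite /F mulrA -PoszD subnKC //; exact: leq_ord.
rewrite sum_antidiagonal.
  by apply: eq_bigr => n _; rewrite mulr_sumr.
by move=> n j leJ; rewrite /F T0 ?mulr0 //; move: leJ; rewrite /J; lia.
Qed.

(** Traces of [1/u = 1/z + 1/2 + Z(u)/u] at [u = ln(1+z)], with weight [(1+z)^(wt a - 1)]. The term
    [1/2] gives half of [c 0], which is zero. *)
Let D_N1 N : D (-1) N = \sum_(i < J) binz C (k%:Z - 1) i * T (i%:Z - 1) N +
  \sum_(n < J) zeta_even_series R n.+1 * D n%:Z N.
Proof.
have lnE := ln_coefN1 (k%:Z - 1) _ (fun=> erefl) (zeta_sinhc R).
pose F n j := zeta_even_series R n *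
  (ln_coef C (n%:Z - 1) (k%:Z - 1) j * T (n%:Z + j%:Z - 1) N).
have FE : \sum_(j < J) \sum_(n < j.+1) F n (j - n)%N =
    \sum_(n < J) zeta_even_series R n.+1 * D n%:Z N.
  rewrite sum_antidiagonal; last first.
    by move=> n j leJ; rewrite /F T0 ?mulr0 //; move: leJ; rewrite /J; lia.
  rewrite /J big_ord_recl [RHS]big_ord_recr /= D0 // mulr0 addr0.
  rewrite [X in X + _]big1 ?add0r; last by move=> j _; rewrite /F mul0r.
  apply: eq_bigr => n _; rewrite /F /D mulr_sumr; apply: eq_bigr => j _.
  rewrite /bump /= add1n (_ : n.+1%:Z - 1 = n%:Z); last by lia.
  by rewrite (_ : n.+1%:Z + j%:Z - 1 = n%:Z + j%:Z) //; lia.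
rewrite -FE.
pose h (j : nat) :=
  1 / 2 * (if j is i.+1 then binz C (k%:Z - 1) i else 0) * T (j%:Z - 1) N.
have half : \sum_(j < J) h j = 0.
  rewrite /J /h big_ord_recl mulr0 mul0r add0r.
  transitivity (1 / 2 * c 0 N); last by rewrite c0 mulr0.
  rewrite /c /J big_ord_recr /= T0 // mulr0 addr0 mulr_sumr; apply: eq_bigr => j _.
  rewrite /bump /= add1n (_ : j.+1%:Z - 1 = j%:Z); last by lia.
  by rewrite [k%:Z - 1 + 0]addr0 -[LHS]mulrA add0n.
transitivity (D (-1) N - \sum_(j < J) h j); first by rewrite half subr0.
rewrite -sumrB -big_split; apply: eq_bigr => j _ /=.
rewrite /h lnE [-1 + _]addrC !mulrDl addrAC addrK; congr (_ + _); rewrite mulr_suml.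
apply: eq_bigr => n _; rewrite /F -mulrA.
by rewrite (_ : n%:Z + (j - n)%N%:Z - 1 = j%:Z - 1) //; have := ltn_ord n; lia.
Qed.

Lemma io_trace_sq0_gcomp N : io_trace (sq_mode a 0 v) N = 0.
Proof.
have : D 0 N = 0.
  (* At [s = 0] only the term [n = 0] of the expansion in powers of [s] survives. *)
  rewrite -(c0 N) cE big_ord_recl expr0 divr1 mul1r big1 ?addr0 // => n _.
  by rewrite expr0n mul0r mul0r.
rewrite D_sq // => /eqP; rewrite mulf_eq0 expfz_eq0 (negPf (two_pi_i_neq0 R)) andbF.
by move=> /eqP.
Qed.

Let D_widen L (f : nat -> C) N : (J <= L)%N ->
  \sum_(n < J) f n * D n%:Z N = \sum_(n < L) f n * D n%:Z N.
Proof.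
move=> leJL; rewrite (big_ord_widen L (fun n => f n * D n%:Z N)) // big_mkcond /=.
by apply: eq_bigr => n _; case: ltnP => // leJn; rewrite D0 ?mulr0 //; exact: ltnW.
Qed.

(** Even powers of [t] cancel and odd ones double, which is the origin of the factor [2] in the
    nonconstant coefficients of [Gtilde]. *)
Let c_odd K (t N : nat) : (J <= K.*2)%N ->
  c t%:Z N - c (- t%:Z) N = \sum_(j < K)
    2%:R * t%:R ^+ j.*2.+1 / j.*2.+1`!%:R * D j.*2.+1 N.
Proof.
move=> leJ; have cL s : c s N = \sum_(n < K.*2) s%:~R ^+ n / n`!%:R * D n%:Z N.
  by rewrite cE; exact: (D_widen (fun n => s%:~R ^+ n / n`!%:R)).
rewrite !cL -sumrB.
rewrite (big_ord_double K (fun n => (t%:Z)%:~R ^+ n / n`!%:R * D n%:Z N -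
   (- t%:Z)%:~R ^+ n / n`!%:R * D n%:Z N)); apply: eq_bigr => j _.
have ev : (- t%:R : C) ^+ j.*2 = t%:R ^+ j.*2.
  by rewrite exprNn -signr_odd odd_double expr0 mul1r.
rewrite mulrNz -pmulrn ev subrr add0r [(- _) ^+ _]exprS ev [t%:R ^+ j.*2.+1]exprS; ring.
Qed.

(** Any [K] with [J0 < K.*2] will do, as all later odd modes kill [v]. The constant terms of
    [Gtilde] come from [zeta_even_series], the others from the Lambert sums. *)
Lemma io_trace_sqN1_gcomp K N : (J0 < K.*2)%N ->
  io_trace (sq_mode a (-1) v) N =
  trace_on (MN N) (fun x => zero_mode (M := M) a (io_zero_mode I v x)) +
  \sum_(j < K) ps_mul (Gtilde R j.+1) (io_trace (sq_mode a ((2 * j.+1)%N%:Z - 1) v)) N.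
Proof.
move=> leJ; have := D_sq N (lexx (-1)); rewrite addNr expr0z mul1r => <-.
rewrite D_N1 associator_trace -addrA; congr (_ + _).
  apply: trace_on_ext => x _ /=.
  rewrite (zero_mode_gcomp _ ak) (io_zero_mode_gcompz I x (vd : gcompz _ d%:Z v)).
  by rewrite /A /B addr0 subr0.
rewrite (@D_widen K.*2 (fun n => zeta_even_series R n.+1)) //.
rewrite (big_ord_double K (fun n => zeta_even_series R n.+1 * D n%:Z N)).
pose P (t i : nat) := (0 < i)%N && (t.+1 %| i)%N.
pose g (j t i : nat) := 2%:R * t.+1%:R ^+ j.*2.+1 / j.*2.+1`!%:R * D j.*2.+1 (N - i)%N.
(* After exchanging the sums, for fixed [j] and [i] the powers of the [t] dividing [i] add up to
   [sigma]. *)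
have -> : \sum_(t < N) \sum_(i < N.+1 | P t i)
    (c t.+1%:Z (N - i)%N - c (- t.+1%:Z) (N - i)%N) =
    \sum_(j < K) \sum_(i < N.+1 | (0 < i)%N)
      2%:R / j.*2.+1`!%:R * (sigma j.*2.+1 i)%:R * D j.*2.+1 (N - i)%N.
  transitivity (\sum_(t < N) \sum_(i < N.+1 | P t i) \sum_(j < K) g j t i).
    by apply: eq_bigr => t _; apply: eq_bigr => i _; exact: c_odd.
  transitivity (\sum_(t < N) \sum_(j < K) \sum_(i < N.+1 | P t i) g j t i).
    by apply: eq_bigr => t _; rewrite exchange_big.
  rewrite exchange_big; apply: eq_bigr => j _ /=.
  rewrite (exchange_big_dep (fun i : 'I_N.+1 => (0 < i)%N)) /=; last by move=> t i _ /andP[].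
  apply: eq_bigr => i i0; rewrite -mulr_suml; congr (_ * _).
  rewrite (eq_bigl (fun t : 'I_N => (t.+1 %| i)%N)); last by move=> t; rewrite /P i0.
  rewrite (sum_divisors (fun t => 2%:R * t%:R ^+ j.*2.+1 / j.*2.+1`!%:R : C)); last first.
    by rewrite i0; exact: leq_ord.
  rewrite /sigma natr_sum mulr_sumr; apply: eq_bigr => t _.
  by rewrite natrX mulrAC.
rewrite -big_split; apply: eq_bigr => j _ /=.
rewrite {1}/zeta_even_series /= odd_double /= mul0r add0r.
rewrite /ps_mul [RHS](bigD1 ord0) //= addrC subn0 /Gtilde /=.
rewrite (_ : (2 * j.+1)%N%:Z - 1 = j.*2.+1%:Z); last by lia.
have DE n : D j.*2.+1 n = two_pi_i R ^+ j.*2.+2 * io_trace (sq_mode a j.*2.+1%:Z v) n.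
  by rewrite D_sq // -PoszD addn1.
have p0 := expf_neq0 j.*2.+2 (two_pi_i_neq0 R).
congr (_ + _).
  rewrite DE /zeta_even_series /= odd_double /= mulrA divfK //.
  by rewrite (_ : (2 * j.+1)%N = j.*2.+2) //; lia.
apply: eq_big => i; first by rewrite lt0n.
move=> i0; rewrite DE (negPf (_ : i != 0%N :> nat)); last by rewrite -lt0n.
rewrite (_ : (2 * j.+1)%N = j.*2.+2); last by lia.
by rewrite subn1 /=; ring.
Qed.

End Homogeneous.

(** * Arbitrary [a] and [v], and the induction on [m] *)

Definition product_trace (a : V) (v : W) : fps C :=
  fun N => trace_on (MN N) (fun x => zero_mode (M := M) a (io_zero_mode I v x)).

Let product_preserves a v N :
  preserves (MN N) (fun x => zero_mode (M := M) a (io_zero_mode I v x)).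
Proof.
have [lin_a aN] := zero_mode_preserves M a N; have [lin_v vN] := io_zero_mode_preserves I v N.
by split=> [c x y|x xN]; [rewrite lin_v lin_a | exact/aN/vN].
Qed.

Lemma product_traceDl a a' v : product_trace (a + a') v = product_trace a v + product_trace a' v.
Proof.
apply/funext => N.
have := trace_on_lin (subM N) (finM N) 1 (product_preserves a v N) (product_preserves a' v N).
rewrite mul1r fpsD /product_trace => <-.
by apply: trace_on_ext => x _; rewrite scale1r (linD (zero_mode_linl _)).
Qed.

Lemma product_traceDr a v v' : product_trace a (v + v') = product_trace a v + product_trace a v'.
Proof.
apply/funext => N.
have := trace_on_lin (subM N) (finM N) 1 (product_preserves a v N) (product_preserves a v' N).
rewrite mul1r fpsD /product_trace => <-.
apply: trace_on_ext => x _; rewrite scale1r (linD (io_zero_mode_linl I x)).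
by rewrite (linD (zero_mode_preserves M a N).1).
Qed.

Lemma io_traceD w w' : io_trace (w + w') = io_trace w + io_trace w'.
Proof. by apply/funext => N; rewrite -[w]scale1r io_trace_lin mul1r scale1r. Qed.

Lemma io_trace_sq0 a v N : io_trace (sq_mode a 0 v) N = 0.
Proof.
have [P a0] := gproj_bound (voa_gr V) a; have [Q v0] := gproj_bound (mod_gr W) v.
have io0 (J : Type) (r : seq J) (w : J -> W) :
    (forall j, io_trace (w j) N = 0) -> io_trace (\sum_(j <- r) w j) N = 0.
  move=> w0; apply: (big_ind (fun w => io_trace w N = 0)) => //; first exact: io_trace0.
  by move=> w1 w2 e1 e2; rewrite io_traceD fpsD e1 e2 addr0.
rewrite (gproj_decomp a0) (lin_sum (sq_mode_linl _ _)); apply: (io0) => p.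
rewrite (gproj_decomp v0) (lin_sum (sq_mode_linr _ _)); apply: (io0) => q.
have [J0 vanish] := @truncated_nat _ _ _ _ _ (gproj (voa_gr V) p a) (gproj (mod_gr W) q v) 0
  (@mod_truncated _ _ W).
apply: (@io_trace_sq0_gcomp p q _ _ (gcomp_gproj _ _ _) (gcomp_gproj _ _ _) J0) => n leJ.
by apply: vanish; rewrite add0r.
Qed.

(** Additive in [a] and in [v] for fixed [K], so that its vanishing reduces to homogeneous
    elements. *)
Let defect K a v : fps C := io_trace (sq_mode a (-1) v) - product_trace a v -
  \sum_(j < K) (Gtilde R j.+1 : fps C) * io_trace (sq_mode a ((2 * j.+1)%N%:Z - 1) v).

Let defectDl K a a' v : defect K (a + a') v = defect K a v + defect K a' v.
Proof.
rewrite /defect (linD (sq_mode_linl _ _)) io_traceD product_traceDl.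
under eq_bigr do rewrite (linD (sq_mode_linl _ _)) io_traceD mulrDr.
by rewrite big_split /=; ring.
Qed.

Let defectDr K a v v' : defect K a (v + v') = defect K a v + defect K a v'.
Proof.
rewrite /defect (linD (sq_mode_linr _ _)) io_traceD product_traceDr.
under eq_bigr do rewrite (linD (sq_mode_linr _ _)) io_traceD mulrDr.
by rewrite big_split /=; ring.
Qed.

(** A threshold instead of a single [K] lets the homogeneous components, each with its own
    truncation, share a common [K]. *)
Lemma io_trace_sqN1 a v : exists K0, forall K, (K0 <= K)%N ->
  io_trace (sq_mode a (-1) v) = product_trace a v +
  \sum_(j < K) (Gtilde R j.+1 : fps C) * io_trace (sq_mode a ((2 * j.+1)%N%:Z - 1) v).
Proof.
suff [K0 defect0] : exists K0, forall K, (K0 <= K)%N -> defect K a v = 0.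
  exists K0 => K /defect0; rewrite /defect => /eqP.
  by rewrite -addrA -opprD subr_eq0 => /eqP.
have [P a0] := gproj_bound (voa_gr V) a; have [Q v0] := gproj_bound (mod_gr W) v.
have defect00 K b w : b = 0 \/ w = 0 -> defect K b w = 0.
  move=> [->|->].
    by apply: (addrI (defect K 0 w)); rewrite -defectDl !addr0.
  by apply: (addrI (defect K b 0)); rewrite -defectDr !addr0.
rewrite (gproj_decomp a0).
apply: (big_ind (fun b => exists K0, forall K, (K0 <= K)%N -> defect K b v = 0)).
- by exists 0 => K _; apply: defect00; left.
- move=> b b' [K1 d1] [K2 d2]; exists (maxn K1 K2) => K; rewrite geq_max => /andP[le1 le2].
  by rewrite defectDl d1 // d2 // addr0.
move=> p _; rewrite (gproj_decomp v0).
apply: (big_ind (fun w => exists K0, forall K, (K0 <= K)%N -> defect K (gproj (voa_gr V) p a) w = 0)).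
- by exists 0 => K _; apply: defect00; right.
- move=> w w' [K1 d1] [K2 d2]; exists (maxn K1 K2) => K; rewrite geq_max => /andP[le1 le2].
  by rewrite defectDr d1 // d2 // addr0.
move=> q _.
have [J0 vanish] := @truncated_nat _ _ _ _ _ (gproj (voa_gr V) p a) (gproj (mod_gr W) q v) 0
  (@mod_truncated _ _ W).
exists J0.+1 => K leK; apply/funext => N.
rewrite /defect fpsD fpsN fpsD fpsN fps_sum.
rewrite (@io_trace_sqN1_gcomp p q _ _ (gcomp_gproj _ _ _) (gcomp_gproj _ _ _) J0 _ K) //.
  by apply/eqP; rewrite -[X in X == _]addrA -opprD subr_eq0; apply/eqP.
by lia.
Qed.

(** Stated for [a[-(m+1)]], so that the first identity is the base case; the [if] carries its
    product term. *)
Lemma io_trace_sqN a v m : exists K0, forall K, (K0 <= K)%N ->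
  io_trace (sq_mode a (- m.+1%:Z) v) = (if m == 0%N then product_trace a v else 0) +
  (-1) ^+ m * \sum_(j < K) 'C(2 * j.+1 - 1, m)%:R *
    ((Gtilde R j.+1 : fps C) * io_trace (sq_mode a ((2 * j.+1)%N%:Z - m.+1%:Z) v)).
Proof.
elim: m a => [|m IHm] a.
  have [K0 e] := io_trace_sqN1 a v; exists K0 => K /e ->; rewrite expr0 mul1r eqxx.
  by congr (_ + _); apply: eq_bigr => j _; rewrite bin0 mul1r.
have [K0 IH] := IHm (sq_derivation a); exists K0 => K /IH {IH}.
have product0 : product_trace (sq_derivation a) v = 0.
  apply/funext => N; apply: (trace_on0 (subM N) (finM N)) => x _.
  exact: zero_mode_sq_derivation.
rewrite product0 if_same !add0r => /(congr1 (fun f => fpsC (two_pi_i R) * f)).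
have shift n : fpsC (two_pi_i R) * io_trace (sq_mode (sq_derivation a) n v) =
    (- n)%:~R * io_trace (sq_mode a (n - 1) v).
  apply/funext => N; rewrite -fpsC_int !fpsCM -!io_traceZ.
  by rewrite sq_derivation_mode.
rewrite shift opprK -pmulrn => e.
(* The factor [m.+1] produced by lowering the mode index [- m.+1] has to be cancelled. *)
have m0 : m.+1%:R * (fpsC m.+1%:R^-1 : fps C) = 1.
  by rewrite -fpsC_nat -fpsC_M mulfV ?pnatr_eq0 //; exact: (fpsC_nat _ 1).
apply: (can_inj (f := fun f : fps C => m.+1%:R * f) (g := fun f => fpsC m.+1%:R^-1 * f)).
  by move=> f; rewrite mulrA [fpsC _ * _]mulrC m0 mul1r.
rewrite (_ : - m.+2%:Z = - m.+1%:Z - 1) ?e; last by lia.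
rewrite exprS mulN1r [LHS]mulrCA [RHS]mulrCA mulNr -mulrN -!mulrN; congr (_ * _).
rewrite mulrN !mulr_sumr -sumrN; apply: eq_bigr => j _.
rewrite [LHS]mulrCA [fpsC _ * _]mulrCA shift.
rewrite (_ : (2 * j.+1)%N%:Z - m.+1%:Z - 1 = (2 * j.+1)%N%:Z + (- m.+1%:Z - 1)); last by lia.
set g := (Gtilde R j.+1 : fps C); set t := io_trace _.
(* With [r = 2j+1] this is ['C(r, m) (r - m) = m.+1 'C(r, m.+1)] up to sign; for [r < m] both sides
   vanish. *)
have bin_rec : 'C(2 * j.+1 - 1, m)%:R * (- ((2 * j.+1)%N%:Z - m.+1%:Z))%:~R =
    - (m.+1%:R * 'C(2 * j.+1 - 1, m.+1)%:R) :> fps C.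
  rewrite -natrM mul_bin_left natrM -mulNr mulrC.
  case: (leqP m (2 * j.+1 - 1)) => [le_m|lt_m]; last by rewrite bin_small // !mulr0.
  congr (_ * _); rewrite pmulrn -mulrNz; congr (_%:~R); lia.
by rewrite [g * (_ * t)]mulrCA [LHS]mulrA bin_rec mulNr -mulrA.
Qed.

End TraceFunctions.

(** * From coefficients back to series with complex exponents *)

Section QSeries.
Variables (R : realType) (V : voa R) (M : ordinary_module V).
Local Notation C := R[i].

Let expo (n : nat) : C := n%:R + conf_weight M - central_charge V / 24%:R.

Let expo_inj : injective expo.
Proof. by move=> n n' /addIr /addIr /eqP; rewrite eqr_nat => /eqP. Qed.

Lemma qtrace_at (A : M -> M) n : qtrace A (expo n) = trace_on (gcomp (mod_gr M) n) A.
Proof.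
rewrite /qtrace (_ : [set _ | _] = [set n]) ?fsbig_set1 //.
by apply/seteqP; split=> n' /= => [/expo_inj|->].
Qed.

Lemma qtrace_off (A : M -> M) e : (forall n, expo n <> e) -> qtrace A e = 0.
Proof.
move=> ne; rewrite /qtrace (_ : [set _ | _] = set0) ?fsbig_set0 //.
by apply/seteqP; split=> n //= /ne.
Qed.

(** For [i > n] the exponent [expo n - i] is not of the form [expo n'], so the product ends at
    [i = n]. *)
Lemma qmul_at f (A : M -> M) n : qmul f (qtrace A) (expo n) =
  ps_mul f (fun N => trace_on (gcomp (mod_gr M) N) A) n.
Proof.
rewrite /qmul (@fsum_ord _ _ n.+1) => [|i lt_ni].
  apply: eq_bigr => i _; rewrite -qtrace_at; congr (_ * qtrace A _).
  by rewrite /expo natrB ?leq_ord //; ring.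
rewrite qtrace_off ?mulr0 // => n' /eqP; rewrite /expo.
rewrite -subr_eq0 (_ : _ - _ = (n' + i)%:R - n%:R); last by rewrite natrD; ring.
by rewrite subr_eq0 eqr_nat => /eqP; lia.
Qed.

Lemma qmul_off f (A : M -> M) e : (forall n, expo n <> e) -> qmul f (qtrace A) e = 0.
Proof.
move=> ne; rewrite /qmul (@fsum_ord _ _ 0) ?big_ord0 // => i _.
rewrite qtrace_off ?mulr0 // => n en; apply: (ne (n + i)%N).
by rewrite -(subrK i%:R e) -en /expo natrD; ring.
Qed.

End QSeries.

Theorem corollary5p14 (R : realType) (V : voa R) (W M : ordinary_module V)
    (W_irr : irreducible_module W) (M_irr : irreducible_module M)
    (I : intertwining_operator W M) (a : V) (v : W) (m : nat)
    (m_ge2 : (2 <= m)%N) :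
  [/\ forall e : R[i],
        qtrace (io_zero_mode I (sq_mode a (-1) v)) e
        = qtrace (fun x : M => zero_mode a (io_zero_mode I v x)) e
          + \sum_(k \in [set k : nat | (1 <= k)%N])
              qmul (Gtilde R k)
                (qtrace (io_zero_mode I (sq_mode a ((2 * k)%:Z - 1) v))) e,
      forall e : R[i], qtrace (io_zero_mode I (sq_mode a 0 v)) e = 0
    & forall e : R[i],
        qtrace (io_zero_mode I (sq_mode a (- m%:Z) v)) e
        + (-1) ^+ m *
          \sum_(k \in [set k : nat | (1 <= k)%N])
            ('C(2 * k - 1, m - 1))%:R *
            qmul (Gtilde R k)
              (qtrace (io_zero_mode I (sq_mode a ((2 * k)%:Z - m%:Z) v))) e
        = 0].
Proof.
have [n0 v0] := sq_mode_truncated a v.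
have qmul0 f w e : w = 0 -> qmul f (qtrace (io_zero_mode I w)) e = 0.
  move=> ->; have [[n <-]|/forallNP ne] := pselect (exists n : nat,
      n%:R + conf_weight M - central_charge V / 24%:R = e); last exact: qmul_off.
  rewrite qmul_at; apply: big1 => i _.
  by rewrite [X in _ * X](io_trace0 I) mulr0.
have [K1 eq1] := io_trace_sqN1 I a v.
have [K2 eq2] := io_trace_sqN I a v m.-1.
have mE : m = m.-1.+1 by lia.
(* The part [n0 + m] makes all modes [a[2k-1]v] and [a[2k-m]v] with [k > K] vanish; [K1] and [K2]
   are the thresholds of the two identities. *)
pose K := maxn (n0 + m) (maxn K1 K2).
split=> e; have [[n <-]|/forallNP ne] := pselect (exists n : nat,
    n%:R + conf_weight M - central_charge V / 24%:R = e).
- rewrite (@fsum_ord1 _ _ K) => [|k leKk]; last first.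
    by apply/qmul0/v0; move: leKk; rewrite /K; lia.
  under eq_bigr do rewrite qmul_at.
  rewrite !qtrace_at -/(io_trace I _ n) (eq1 K); last by rewrite /K; lia.
  by rewrite fpsD fps_sum.
- rewrite !qtrace_off // add0r (@fsum_ord1 _ _ 0) ?big_ord0 // => k _.
  by rewrite qmul_off.
- by rewrite qtrace_at; exact: io_trace_sq0.
- by rewrite qtrace_off.
- rewrite (@fsum_ord1 _ _ K) => [|k leKk]; last first.
    by rewrite qmul0 ?mulr0 //; apply: v0; move: leKk; rewrite /K; lia.
  under eq_bigr do rewrite qmul_at.
  rewrite qtrace_at -/(io_trace I _ n) {1}mE (eq2 K); last by rewrite /K; lia.
  (* Since [m >= 2], the product term is absent. *)
  rewrite ifF ?add0r; last by lia.
  have sign (j : nat) (f : fps R[i]) : ((-1) ^+ j * f) n = (-1) ^+ j * f n.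
    by elim: j f => [|j IHj] f; rewrite ?expr0 ?mul1r // !exprS !mulN1r !mulNr fpsN IHj.
  (* [eq2] carries the sign [(-1)^(m-1)], opposite to the one in the statement, so the two terms
     cancel. *)
  rewrite sign fps_sum [in (-1) ^+ m]mE exprS mulN1r mulNr.
  apply/eqP; rewrite subr_eq0; apply/eqP; congr (_ * _); apply: eq_bigr => j _.
  by rewrite -fpsC_nat fpsCM -mE (subn1 m).
- rewrite qtrace_off // add0r (@fsum_ord1 _ _ 0) ?big_ord0 ?mulr0 // => k _.
  by rewrite qmul_off // mulr0.
Qed.
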